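(* Let $T$ be a complete first-order theory with infinite models and monster model $\mathcal{U}$, and let $B\subseteq U$ be a small set. Suppose $T$ is $m$-distal and $n>m>0$. If $p_0(x_0),\ldots,p_{n-1}(x_{n-1})\in S_U$ are invariant over $B$ and commute pairwise, then the product $p_0\otimes\cdots\otimes p_{n-1}$ is $m$-determined.
   Context: Conventions. $T$ is a complete first-order theory in a language $L$ with infinite models, and $\mathcal{U}\models T$, with universe $U$, is a monster model: universal and strongly $\hat\kappa$-homogeneous for a sufficiently large cardinal $\hat\kappa$. ''Small'' means of cardinality $<\hat\kappa$. Variables and parameters may be tuples (finite or infinite, small); all sequences of parameters are small. No NIP assumption is made. EM-types. A sequence $\mathcal{I}=(b_i:i\in I)$ of tuples of the same size, indexed by an infinite linear order, satisfies $\mathcal I\models^{\mathrm{EM}}\phi(x_0,\dots,x_{n-1})$ if $\mathcal{U}\models\phi(b_{i_0},\dots,b_{i_{n-1}})$ for all $i_0<\cdots<i_{n-1}$ in $I$. The EM-type of $\mathcal I$ (over $\varnothing$) is the set of all $L$-formulas $\phi$ in variables $(x_k:k<\omega)$ with $\mathcal I\models^{\mathrm{EM}}\phi$; $\mathcal I$ is indiscernible iff this EM-type is complete. A complete EM-type is the EM-type of some infinite indiscernible sequence. Dedekind partitions. A partition $I=I_0+\cdots+I_n$ of a linear order into nonempty convex sets $I_0<\cdots<I_n$ is Dedekind if for each $i<n$ the set $I_0\cup\cdots\cup I_i$ has no maximum and $I_{i+1}\cup\cdots\cup I_n$ has no minimum; the $i$-th cut is $\mathfrak c_i=(I_0\cup\cdots\cup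 I_i,\ I_{i+1}\cup\cdots\cup I_n)$. For an indiscernible sequence $\mathcal I$ indexed by $I$, write $\mathcal I=\mathcal I_0+\cdots+\mathcal I_n$ for the corresponding partition. Given $A=(a_0,\dots,a_{n-1})$ of tuples of the same size as those in $\mathcal I$, a subsequence $A'\subseteq A$ inserts into $\mathcal I_0+\cdots+\mathcal I_n$ if the sequence obtained by inserting each $a_i\in A'$ at the cut $\mathfrak c_i$ is indiscernible. $m$-distality. For $n>m>0$, the Dedekind partition $\mathcal I_0+\cdots+\mathcal I_n$ of an indiscernible sequence is $m$-distal if every sequence $A=(a_0,\dots,a_{n-1})$ which does not insert contains an $m$-element subsequence which does not insert. A complete EM-type $\Gamma$ is $m$-distal if every Dedekind partition $\mathcal I_0+\cdots+\mathcal I_{m+1}$ of an indiscernible sequence with EM-type $\Gamma$ is $m$-distal. $T$ is $m$-distal if every complete EM-type, in every tuple size, is $m$-distal. Invariant types and products. $S_U(x)$ is the set of complete types over $U$ in $x$. A global type $p(x)\in S_U$ is invariant over a small $A\subseteq U$ if for all $\phi(x,d)\in p$ and all $d'\equiv_A d$ in $U$, $\phi(x,d')\in p$. For $p(x),q(y)\in S_U$ with $q$ invariant over a small set $A$, the product $p\otimes q\in S_U(x,y)$ is given by: $\phi(x,y,d)\in p\otimes q$ iff for all $a\in U$ realizing $p\restriction_{Ad}$, $\phi(a,y,d)\in q$. This operation is associative. Two invariant types commute if $p(x)\otimes q(y)=q(y)\otimes p(x)$. Determinacy. For $n>m>0$ and $C\subseteq U$ (possibly $C=U$), a type $p\in S_C(x_0,\dots,x_{n-1})$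 is $m$-determined if it is completely determined by its restrictions to $m$ of the variables, i.e. $p$ is the only type in $S_C(x_0,\dots,x_{n-1})$ containing every $q\in S_C(x_{i_0},\dots,x_{i_{m-1}})$ with $i_0<\cdots<i_{m-1}<n$ and $q\subseteq p$. *)

(* Defs.v *)
From HB Require Import structures.
From mathcomp Require Import all_boot all_order.
From mathcomp Require Import boolp classical_sets functions cardinality.

Set Implicit Arguments.
Unset Strict Implicit.
Unset Printing Implicit Defensive.

Import Order.TTheory.

Local Open Scope classical_set_scope.

(** * First-order logic *)

Record language := Language {
  fsym : Type;
  farity : fsym -> nat;
  rsym : Type;
  rarity : rsym -> nat }.

(* [term L V] and [formula L V] have their free variables in the type [V];
   a tuple of variables of arbitrary (possibly infinite) size is a type.
   [All] binds the variable [None] of [option V].  An L(C)-formula in the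
   variables [V] is an element of [formula L (V + C)]. *)
Inductive term (L : language) (V : Type) : Type :=
| Var of V
| App (f : fsym L) of ('I_(farity f) -> term L V).

Inductive formula (L : language) (V : Type) : Type :=
| Bot
| Eq of term L V & term L V
| Rel (r : rsym L) of ('I_(rarity r) -> term L V)
| Imp of formula L V & formula L V
| All of formula L (option V).

Arguments Bot {L V}.

Definition Neg (L : language) (V : Type) (phi : formula L V) : formula L V :=
  Imp phi Bot.

Fixpoint trename (L : language) (V W : Type) (h : V -> W) (t : term L V) :
    term L W :=
  match t with
  | Var v => Var L (h v)
  | App f ts => App (fun i => trename h (ts i))
  end.

(* Since [h] is extended by [omap] under a quantifier, no variable is ever
   captured. *)
Fixpoint frename (L : language) (V W : Type) (h : V -> W) (phi : formula L V) :
    formula L W :=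
  match phi with
  | Bot => Bot
  | Eq t u => Eq (trename h t) (trename h u)
  | Rel r ts => Rel (fun i => trename h (ts i))
  | Imp phi psi => Imp (frename h phi) (frename h psi)
  | All phi => All (frename (omap h) phi)
  end.

Fixpoint tvars (L : language) (V : Type) (t : term L V) : set V :=
  match t with
  | Var v => [set v]
  | App f ts => [set v | exists i, tvars (ts i) v]
  end.

Fixpoint fvars (L : language) (V : Type) (phi : formula L V) : set V :=
  match phi with
  | Bot => set0
  | Eq t u => tvars t `|` tvars u
  | Rel r ts => [set v | exists i, tvars (ts i) v]
  | Imp phi psi => fvars phi `|` fvars psi
  | All phi => [set v | fvars phi (Some v)]
  end.

Record structure (L : language) := Structure {
  domain :> Type;
  domain_inh : inhabited domain;
  finterp : forall f : fsym L, ('I_(farity f) -> domain) -> domain;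
  rinterp : forall r : rsym L, ('I_(rarity r) -> domain) -> Prop }.

Fixpoint teval (L : language) (M : structure L) (V : Type) (e : V -> M)
    (t : term L V) : M :=
  match t with
  | Var v => e v
  | App f ts => finterp (fun i => teval e (ts i))
  end.

Fixpoint sat (L : language) (M : structure L) (V : Type) (e : V -> M)
    (phi : formula L V) : Prop :=
  match phi with
  | Bot => False
  | Eq t u => teval e t = teval e u
  | Rel r ts => rinterp (fun i => teval e (ts i))
  | Imp phi psi => sat e phi -> sat e psi
  | All phi => forall a : M, sat (oapp e a) phi
  end.

Definition copair (V C W : Type) (e : V -> W) (c : C -> W) (z : V + C) : W :=
  match z with inl v => e v | inr u => c u end.

Definition sentence (L : language) : Type := formula L void.

Definition theory (L : language) : Type := set (sentence L).

Definition holds (L : language) (M : structure L) (s : sentence L) : Prop :=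
  sat (of_void M) s.

Definition models (L : language) (M : structure L) (T : theory L) : Prop :=
  forall s, T s -> holds M s.

Definition entails (L : language) (T : theory L) (s : sentence L) : Prop :=
  forall M : structure L, models M T -> holds M s.

Definition complete_theory (L : language) (T : theory L) : Prop :=
  (exists M : structure L, models M T) /\
  (forall s, entails T s \/ entails T (Neg s)).

Definition has_infinite_model (L : language) (T : theory L) : Prop :=
  exists M : structure L, models M T /\ infinite_set [set: M].

(** * Monster models *)

(* The cardinal of the monster model is that of a type [K]; [small K A] says
   that [A] has cardinality smaller than [K]. *)
Definition small (K V : Type) (A : set V) : Prop :=
  (A #<= [set: K])%card /\ ~ ([set: K] #<= A)%card.

Definition elementary_embedding (L : language) (M N : structure L)
    (h : M -> N) : Prop :=
  forall (k : nat) (phi : formula L 'I_k) (e : 'I_k -> M),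
    sat e phi <-> sat (h \o e) phi.

Definition automorphism (L : language) (M : structure L) (s : M -> M) : Prop :=
  [/\ bijective s,
      forall (f : fsym L) (a : 'I_(farity f) -> M),
        s (finterp a) = finterp (s \o a) &
      forall (r : rsym L) (a : 'I_(rarity r) -> M),
        rinterp a <-> rinterp (s \o a)].

Definition universal (L : language) (T : theory L) (K : Type)
    (U : structure L) : Prop :=
  forall M : structure L, models M T -> small K [set: M] ->
    exists h : M -> U, elementary_embedding h.

Definition partial_elementary (L : language) (U : structure L) (A : set U)
    (f : A -> U) : Prop :=
  forall phi : formula L A, sat (fun a : A => val a) phi <-> sat f phi.

Definition strongly_homogeneous (L : language) (K : Type)
    (U : structure L) : Prop :=
  forall (A : set U) (f : A -> U), small K A -> partial_elementary f ->
    exists s : U -> U, automorphism s /\ forall a : A, s (val a) = f a.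

(* The cardinal [K] is "sufficiently large" when it exceeds aleph_0 and the
   number of symbols of the language. *)
Record monster (L : language) (T : theory L) (K : Type) (U : structure L) :
    Prop := Monster {
  monster_models : models U T;
  monster_universal : universal T K U;
  monster_homogeneous : strongly_homogeneous K U;
  monster_large_nat : small K [set: nat];
  monster_large_fsym : small K [set: fsym L];
  monster_large_rsym : small K [set: rsym L] }.

(** * EM-types and m-distality *)

Section EM.
Variables (L : language) (U : structure L) (S : Type).

(* A set of formulas phi(x_0, ..., x_(n-1)), sorted by [n]; every x_k is a
   tuple of variables of size [S]. *)
Definition EM_set : Type := forall n : nat, set (formula L ('I_n * S)).

(* The index set [J] is ordered by the strict order [lt]. *)
Definition EM_type (J : Type) (lt : rel J) (b : J -> S -> U) : EM_set :=
  fun n => [set phi | forall j : 'I_n -> J,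
    (forall k l : 'I_n, (k < l)%N -> lt (j k) (j l)) ->
    sat (fun ks => b (j ks.1) ks.2) phi].

Definition EM_complete (G : EM_set) : Prop :=
  forall (n : nat) (phi : formula L ('I_n * S)), G n phi \/ G n (Neg phi).

Definition indiscernible (J : Type) (lt : rel J) (b : J -> S -> U) : Prop :=
  EM_complete (EM_type lt b).

Definition complete_EM_type (K : Type) (G : EM_set) : Prop :=
  exists (d : Order.disp_t) (I : orderType d) (b : I -> S -> U),
    [/\ infinite_set [set: I], small K [set: I],
        indiscernible <%O b & EM_type <%O b = G].

(* A partition I_0 + ... + I_n of [I] into nonempty convex sets
   I_0 < ... < I_n is given by the map [c] sending the elements of I_k to
   [k]; the cut c_k, for k < n, lies between [c x <= k] and [k < c x]. *)
Definition dedekind (d : Order.disp_t) (I : orderType d) (n : nat)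
    (c : I -> 'I_n.+1) : Prop :=
  [/\ forall x y : I, (x <= y)%O -> (c x <= c y)%N,
      forall k : 'I_n.+1, exists x : I, c x = k,
      forall (k : 'I_n) (x : I), (c x <= k)%N ->
        exists y : I, (x < y)%O /\ (c y <= k)%N &
      forall (k : 'I_n) (x : I), (k < c x)%N ->
        exists y : I, (y < x)%O /\ (k < c y)%N].

Section Insertion.
Variables (d : Order.disp_t) (I : orderType d) (n : nat) (c : I -> 'I_n.+1).

(* [I] extended by one new point at each of the cuts c_k with [k \in A]. *)
Definition ins_index (A : {set 'I_n}) : Type := (I + {k : 'I_n | k \in A})%type.

Definition ins_lt (A : {set 'I_n}) : rel (ins_index A) := fun x y =>
  match x, y with
  | inl i, inl j => (i < j)%O
  | inl i, inr k => (c i <= val k)%N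
  | inr k, inl j => (val k < c j)%N
  | inr k, inr l => (val k < val l)%N
  end.

Definition ins_seq (b : I -> S -> U) (a : 'I_n -> S -> U) (A : {set 'I_n}) :
    ins_index A -> S -> U :=
  fun x => match x with inl i => b i | inr k => a (val k) end.

(* The subsequence of a_0, ..., a_(n-1) with indices in [A] inserts. *)
Definition inserts (b : I -> S -> U) (a : 'I_n -> S -> U) (A : {set 'I_n}) :
    Prop :=
  indiscernible (@ins_lt A) (@ins_seq b a A).

Definition distal_partition (m : nat) (b : I -> S -> U) : Prop :=
  forall a : 'I_n -> S -> U, ~ inserts b a [set: 'I_n]%SET ->
    exists A : {set 'I_n}, #|A| = m /\ ~ inserts b a A.

End Insertion.

Definition distal_EM_type (K : Type) (m : nat) (G : EM_set) : Prop :=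
  forall (d : Order.disp_t) (I : orderType d) (b : I -> S -> U)
      (c : I -> 'I_m.+2),
    small K [set: I] -> indiscernible <%O b -> EM_type <%O b = G ->
    dedekind c -> distal_partition c m b.

End EM.

(* m-distality of the theory of the monster model [U]. *)
Definition distal (L : language) (K : Type) (U : structure L) (m : nat) :
    Prop :=
  forall S : Type, small K [set: S] ->
  forall G : EM_set L S, complete_EM_type U K G -> distal_EM_type U K m G.

(** * Global types *)

Section Types.
Variables (L : language) (U : structure L).

(* [complete_type p] says that [p] is in S_U(x), the variables x being
   indexed by [X]. *)
Definition complete_type (X : Type) (p : set (formula L (X + U))) : Prop :=
  (forall F : set (formula L (X + U)), finite_set F -> F `<=` p ->
     exists a : X -> U, forall phi, F phi -> sat (copair a id) phi) /\
  (forall phi, p phi \/ p (Neg phi)).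

Definition same_type (A : set U) (k : nat) (d d' : 'I_k -> U) : Prop :=
  forall phi : formula L ('I_k + A),
    sat (copair d (fun u : A => val u)) phi <->
    sat (copair d' (fun u : A => val u)) phi.

(* The formula phi(x, d) over U, for an L-formula phi(x, y). *)
Definition inst (X : Type) (k : nat) (d : 'I_k -> U)
    (phi : formula L (X + 'I_k)) : formula L (X + U) :=
  frename (copair inl (inr \o d)) phi.

Definition invariant_type (A : set U) (X : Type) (p : set (formula L (X + U))) :
    Prop :=
  forall (k : nat) (phi : formula L (X + 'I_k)) (d d' : 'I_k -> U),
    p (inst d phi) -> same_type A d d' -> p (inst d' phi).

Definition restr (X : Type) (C : set U) (p : set (formula L (X + U))) :
    set (formula L (X + C)) :=
  [set phi | p (frename (copair inl (fun u : C => inr (val u))) phi)].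

Definition realizes (X : Type) (C : set U) (q : set (formula L (X + C)))
    (a : X -> U) : Prop :=
  forall phi, q phi -> sat (copair a (fun u : C => val u)) phi.

Definition params (X : Type) (phi : formula L (X + U)) : set U :=
  [set u | fvars phi (inr u)].

(* From phi(x, y, d) and [a] to phi(a, y, d). *)
Definition plug (X Y : Type) (a : X -> U) (phi : formula L ((X + Y) + U)) :
    formula L (Y + U) :=
  frename (copair (copair (inr \o a) inl) inr) phi.

(* The product of [p] and [q], for [q] invariant over [A]; the tuple d in
   phi(x, y, d) consists of the parameters that occur in the formula. *)
Definition otimes (A : set U) (X Y : Type) (p : set (formula L (X + U)))
    (q : set (formula L (Y + U))) : set (formula L ((X + Y) + U)) :=
  [set phi | forall a : X -> U,
     realizes (@restr X (A `|` params phi) p) a -> q (plug a phi)].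

(* Equality of the two products in S_U(x, y), where the variables of the
   second one are listed as (y, x). *)
Definition swap_vars (X Y : Type) : (X + Y) + U -> (Y + X) + U :=
  copair (inl \o copair inr inl) inr.

Definition commuting_types (A : set U) (X Y : Type) (p : set (formula L (X + U)))
    (q : set (formula L (Y + U))) : Prop :=
  forall phi : formula L ((X + Y) + U),
    otimes A p q phi <-> otimes A q p (frename (@swap_vars X Y) phi).

(* The variables (x_0, ..., x_(n-1)), where x_i is indexed by [X i]. *)
Definition tuple_vars (n : nat) (X : 'I_n -> Type) : Type := {i : 'I_n & X i}.

Definition snoc_vars (n : nat) (X : 'I_n.+1 -> Type) :
    (tuple_vars (fun i => X (lift ord_max i)) + X ord_max) + U ->
    tuple_vars X + U :=
  copair (inl \o copair (fun z => existT X (lift ord_max (projT1 z)) (projT2 z))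
                    (fun x => existT X ord_max x))
       inr.

(* The product of p_0, ..., p_(n-1), associated to the left; note that
   [lift ord_max i] has the same value as [i].  The empty product is the
   complete type of the empty tuple. *)
Fixpoint otimes_seq (A : set U) (n : nat) :
    forall X : 'I_n -> Type, (forall i, set (formula L (X i + U))) ->
    set (formula L (tuple_vars X + U)) :=
  match n with
  | 0 => fun X p => [set phi | exists a : tuple_vars X -> U,
                                 sat (copair a id) phi]
  | n'.+1 => fun X p =>
      frename (@snoc_vars n' X) @`
        otimes A (otimes_seq A (fun i => p (lift ord_max i))) (p ord_max)
  end.

Definition select_vars (n m : nat) (X : 'I_n -> Type) (i : 'I_m -> 'I_n) :
    tuple_vars (X \o i) + U -> tuple_vars X + U :=
  copair (fun z => inl (existT X (i (projT1 z)) (projT2 z))) inr.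

Definition determined_type (m n : nat) (X : 'I_n -> Type)
    (p : set (formula L (tuple_vars X + U))) : Prop :=
  complete_type p /\
  forall r : set (formula L (tuple_vars X + U)), complete_type r ->
    (forall i : 'I_m -> 'I_n, (forall k l : 'I_m, (k < l)%N -> (i k < i l)%N) ->
     forall q : set (formula L (tuple_vars (X \o i) + U)), complete_type q ->
       frename (@select_vars n m X i) @` q `<=` p ->
       frename (@select_vars n m X i) @` q `<=` r) ->
    r = p.

End Types.

(* Main.v *)
Require Import Defs.
From mathcomp Require Import all_boot all_order ssralg ssrint.
From mathcomp Require Import zify.
From mathcomp Require Import boolp classical_sets functions cardinality filter.

(* Let r be a complete type over U with the same m-restrictions as the product
   p of the p_i, and let a realize r over a small set C containing B.  It is
   enough that every a_k realizes p_k over C and the other a_j, as then a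
   realizes p over C.  This holds inside every m-element set of indices, and it
   passes from the sets obtained by removing one index to the whole set as
   follows.  Take an array with rows indexed by a Dedekind partition with m+1
   cuts, whose j-th column is a Morley sequence of p_(i j), and let a_(i j) be
   the j-th entry of the row at the j-th cut.  Because the p_i commute, the
   columns can be realized in any order relative to each other; so the part of
   column j before its cut is realized first, then a, then the rest.  If one of
   the a_(i j) is dropped, what is left is a Morley sequence of a product of
   commuting types, hence any m of the m+1 rows insert.  By m-distality they all
   insert, and then (a_(i 0), ..., a_(i m)) has the same type over C as a tuple
   of entries in the other rows.

   Realizations exist because a universal and strongly homogeneous model is
   saturated: a finitely satisfiable small type is realized in the quotient, by
   an ultrafilter, of a small set of Skolem terms. *)

Set Implicit Arguments.
Unset Strict Implicit.
Unset Printing Implicit Defensive.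

Import Order.TTheory.

Local Open Scope classical_set_scope.

(** * Renaming of variables *)

Section Syntax.
Variable L : language.

Lemma trename_comp (V W Z : Type) (g : W -> Z) (h : V -> W) (t : term L V) :
  trename g (trename h t) = trename (g \o h) t.
Proof.
elim: t => //= f ts IH.
by congr App; apply/funext => i; exact: IH.
Qed.

Lemma frename_comp (V : Type) (phi : formula L V) :
  forall (W Z : Type) (g : W -> Z) (h : V -> W),
  frename g (frename h phi) = frename (g \o h) phi.
Proof.
elim: phi => {V} //=.
- by move=> V t u W Z g h; rewrite !trename_comp.
- move=> V r ts W Z g h; congr Rel; apply/funext => i; exact: trename_comp.
- by move=> V phi IH1 psi IH2 W Z g h; rewrite IH1 IH2.
- move=> V phi IH W Z g h; rewrite IH; congr (All (frename _ phi)).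
  by apply/funext => -[].
Qed.

Lemma trename_id (V : Type) (t : term L V) : trename id t = t.
Proof. by elim: t => //= f ts IH; congr App; apply/funext. Qed.

Lemma frename_id (V : Type) (phi : formula L V) : frename id phi = phi.
Proof.
elim: phi => {V} //=.
- by move=> V t u; rewrite !trename_id.
- by move=> V r ts; congr Rel; apply/funext => i; exact: trename_id.
- by move=> V phi IH1 psi IH2; rewrite IH1 IH2.
- move=> V phi IH; rewrite -[in RHS]IH; congr (All (frename _ phi)).
  by apply/funext => -[].
Qed.

Lemma teval_rename (M : structure L) (V W : Type) (e : W -> M) (h : V -> W)
    (t : term L V) : teval e (trename h t) = teval (e \o h) t.
Proof.
by elim: t => //= f ts IH; congr finterp; apply/funext => i; exact: IH.
Qed.

Lemma sat_rename (M : structure L) (V : Type) (phi : formula L V) :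
  forall (W : Type) (e : W -> M) (h : V -> W),
  sat e (frename h phi) = sat (e \o h) phi.
Proof.
elim: phi => {V} //=.
- by move=> V t u W e h; rewrite !teval_rename.
- move=> V r ts W e h; congr rinterp; apply/funext => i; exact: teval_rename.
- by move=> V phi IH1 psi IH2 W e h; rewrite IH1 IH2.
- move=> V phi IH W e h; apply/propext; split=> H a; have := H a; rewrite IH;
    congr (sat _ _); by apply/funext => -[].
Qed.

Lemma teval_ext_on (M : structure L) (V : Type) (e e' : V -> M) (t : term L V) :
  (forall v, tvars t v -> e v = e' v) -> teval e t = teval e' t.
Proof.
elim: t => [v /(_ v erefl)//|f ts IH H] /=; congr finterp; apply/funext => i.
by apply: IH => v tv; apply: H; exists i.
Qed.

Lemma sat_ext_on (M : structure L) (V : Type) (phi : formula L V) :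
  forall (e e' : V -> M),
  (forall v, fvars phi v -> e v = e' v) -> sat e phi = sat e' phi.
Proof.
elim: phi => {V} //=.
- by move=> V t u e e' H; rewrite (teval_ext_on (e' := e')) ?(@teval_ext_on _ _ e e' u)// => v tv;
    apply: H; [right|left].
- move=> V r ts e e' H; congr rinterp; apply/funext => i.
  by apply: teval_ext_on => v tv; apply: H; exists i.
- by move=> V phi IH1 psi IH2 e e' H; rewrite (IH1 e e') ?(IH2 e e')// => v tv;
    apply: H; [right|left].
- move=> V phi IH e e' H; apply/propext; split=> Ha a; have := Ha a;
    by rewrite (IH _ (oapp e' a))// => -[v|]//= pv; apply: H.
Qed.

Lemma tvars_rename (V W : Type) (h : V -> W) (t : term L V) :
  tvars (trename h t) = h @` tvars t.
Proof.
elim: t => /= [v|f ts IH]; first by rewrite image_set1.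
apply/seteqP; split=> [w [i]|w [v [i tv] <-]].
  by rewrite IH => -[v tv <-]; exists v => //; exists i.
by exists i; rewrite IH; exists v.
Qed.

Lemma fvars_rename (V : Type) (phi : formula L V) : forall (W : Type) (h : V -> W),
  fvars (frename h phi) = h @` fvars phi.
Proof.
elim: phi => {V} /=.
- by move=> V W h; rewrite image_set0.
- by move=> V t u W h; rewrite image_setU !tvars_rename.
- move=> V r ts W h; apply/seteqP; split=> [w [i]|w [v [i tv] <-]].
    by rewrite tvars_rename => -[v tv <-]; exists v => //; exists i.
  by exists i; rewrite tvars_rename; exists v.
- by move=> V phi IH1 psi IH2 W h; rewrite image_setU IH1 IH2.
- move=> V phi IH W h; apply/seteqP; split=> [w /=|w [v pv <-]] /=.
    by rewrite IH => -[[v|]// pv [<-]]; exists v.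
  by rewrite IH; exists (Some v).
Qed.

Lemma tvars_finite (V : Type) (t : term L V) : finite_set (tvars t).
Proof.
elim: t => /= [v|f ts IH]; first exact: finite_set1.
rewrite (_ : mkset _ = \bigcup_(i in [set: 'I_(farity f)]) tvars (ts i)).
  by apply: bigcup_finite => // i _.
by apply/seteqP; split => v [i]; [exists i|move=> ?; exists i].
Qed.

Lemma fvars_finite (V : Type) (phi : formula L V) : finite_set (fvars phi).
Proof.
elim: phi => {V} /=.
- by move=> V; exact: finite_set0.
- by move=> V t u; rewrite finite_setU; split; exact: tvars_finite.
- move=> V r ts; rewrite (_ : mkset _ = \bigcup_(i in [set: 'I_(rarity r)]) tvars (ts i)).
    by apply: bigcup_finite => // i _; exact: tvars_finite.
  by apply/seteqP; split => v [i]; [exists i|move=> ?; exists i].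
- by move=> V phi IH1 psi IH2; rewrite finite_setU.
- move=> V phi IH.
  have inj : {in [set v | fvars phi (Some v)] &, injective (@Some V)} by move=> ? ? _ _ [].
  rewrite -(eq_finite_set (inj_card_eq inj)).
  by apply: sub_finite_set IH => _ [v /= pv <-].
Qed.

Lemma trename_lift (V W : Type) (g : W -> V) (P : set W) (t : term L V) :
  (forall v, tvars t v -> exists2 w, P w & g w = v) ->
  exists2 t0 : term L W, trename g t0 = t & tvars t0 `<=` P.
Proof.
elim: t => [v /(_ v erefl)[w Pw <-]|f ts IH H].
  by exists (Var L w) => // _ ->.
have /choice[us Hus] : forall i, exists u : term L W, trename g u = ts i /\ tvars u `<=` P.
  by move=> i; have [v tv|u ? ?] := IH i; [apply: H; exists i|exists u].
exists (App us) => /= [|w [i]]; last by case: (Hus i) => _; exact.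
by congr App; apply/funext => i; case: (Hus i).
Qed.

(* A formula can be pulled back along a map whose image contains its free
   variables, even when no map backwards exists. *)
Lemma frename_lift (V : Type) (phi : formula L V) :
  forall (W : Type) (g : W -> V) (P : set W),
  (forall v, fvars phi v -> exists2 w, P w & g w = v) ->
  exists2 phi0 : formula L W, frename g phi0 = phi & fvars phi0 `<=` P.
Proof.
elim: phi => {V}.
- by move=> V W g P _; exists Bot.
- move=> V t u W g P H.
  have [|t0 <- Pt] := @trename_lift V W g P t; first by move=> v tv; apply: H; left.
  have [|u0 <- Pu] := @trename_lift V W g P u; first by move=> v tv; apply: H; right.
  by exists (Eq t0 u0) => // w [/Pt|/Pu].
- move=> V r ts W g P H.
  have /choice[us Hus] : forall i, exists u : term L W, trename g u = ts i /\ tvars u `<=` P.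
    move=> i; have [v tv|u ? ?] := @trename_lift V W g P (ts i); last by exists u.
    by apply: H; exists i.
  exists (Rel us) => /= [|w [i]]; last by case: (Hus i) => _; exact.
  by congr Rel; apply/funext => i; case: (Hus i).
- move=> V phi IH1 psi IH2 W g P H.
  have [|phi0 <- P1] := IH1 W g P; first by move=> v tv; apply: H; left.
  have [|psi0 <- P2] := IH2 W g P; first by move=> v tv; apply: H; right.
  by exists (Imp phi0 psi0) => // w [/P1|/P2].
- move=> V phi IH W g P H.
  have [[v /H[w Pw <-]|_]|phi0 <- Pphi] := IH _ (omap g)
      [set w | if w is Some w then P w else True].
  + by exists (Some w).
  + by exists None.
  + by exists (All phi0) => // w /Pphi.
Qed.

End Syntax.

(** Elementarity and invariance are defined for tuples indexed by ['I_k]; this enumeration of the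
    free variables of a formula reduces arbitrary tuples to that case. *)
Lemma finite_set_ord (V : Type) (A : set V) : finite_set A ->
  exists k (v : 'I_k -> V), range v = A.
Proof.
move=> /(@finite_seqP {classic V})[s ->].
exists (size s), (tnth (in_tuple s)); apply/seteqP; split => [_ [i _ <-]|v /= vs].
  exact: mem_tnth.
have /tnthP[i ->] : v \in in_tuple s by [].
by exists i.
Qed.

(** * Cardinals below [K] *)

Lemma card_leTP (A B : Type) :
  ([set: A] #<= [set: B])%card <-> exists f : A -> B, injective f.
Proof.
split=> [/card_leP[f]|[f finj]].
  exists (fun x => val (f (SigSub (mem_set (I : [set: A] x))))) => x y /val_inj.
  by move=> /(@inj _ _ _ f); rewrite !inE => /(_ Logic.I Logic.I)[].
have {}finj : set_inj [set: A] f by move=> x y _ _; exact: finj.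
have := @inj_card_eq _ _ setT f finj.
rewrite card_eq_sym => /card_eqPle[+ _] => /card_le_trans; apply.
exact: subset_card_le.
Qed.

(** Zorn's lemma gives a maximal graph of a partial injection. If it missed a point on each side,
    that pair could be added to it. *)
Lemma card_trichotomy (A B : Type) :
  (exists f : A -> B, injective f) \/ (exists f : B -> A, injective f).
Proof.
pose P (G : set (A * B)) := (forall a b b', G (a, b) -> G (a, b') -> b = b') /\
  (forall a a' b, G (a, b) -> G (a', b) -> a = a').
have [F FP Ftot|G [[G1 G2] Gmax]] := @Zorn_bigcup _ P.
  have F2 (X Y : set (A * B)) u v : F X -> F Y -> X u -> Y v ->
      exists2 Z, F Z & Z u /\ Z v.
    move=> FX FY Xu Yv; have [XY|YX] := Ftot _ _ FX FY.
      by exists Y => //; split=> //; exact: XY.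
    by exists X => //; split=> //; exact: YX.
  split=> [a b b' [X FX Xab] [Y FY Yab]|a a' b [X FX Xab] [Y FY Yab]];
    have [Z /FP[Z1 Z2] [Zu Zv]] := F2 _ _ _ _ FX FY Xab Yab.
  - exact: Z1 Zu Zv.
  - exact: Z2 Zu Zv.
have [/choice[f Gf]|/existsNP[a0 na0]] := pselect (forall a, exists b, G (a, b)).
  by left; exists f => x y fxy; apply: (G2 _ _ (f x)); rewrite ?Gf// fxy.
have [/choice[f Gf]|/existsNP[b0 nb0]] := pselect (forall b, exists a, G (a, b)).
  by right; exists f => x y fxy; apply: (G1 (f x)); rewrite ?Gf// fxy.
exfalso; apply: (Gmax (G `|` [set (a0, b0)])).
  split=> [x|]; first by left.
  by move=> /(_ (a0, b0))/(_ (or_intror erefl)) Gab; apply: na0; exists b0.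
split.
- move=> a b b' [Gab|[-> ->]] [Gab'|] //.
  + exact: G1 Gab Gab'.
  + by move=> [ea _]; exfalso; apply: na0; exists b; rewrite -ea.
  + by exfalso; apply: na0; exists b'.
  + by move=> [->].
- move=> a a' b [Gab|[-> ->]] [Gab'|] //.
  + exact: G2 Gab Gab'.
  + by move=> [_ eb]; exfalso; apply: nb0; exists a; rewrite -eb.
  + by exfalso; apply: nb0; exists a'.
  + by move=> [->].
Qed.

(** * Squares of infinite types *)

Section Square.
Variables (W : Type) (h : nat -> W) (hinj : injective h).

Let dom (G : set ((W * W) * W)) : set W := [set x | exists z, G ((x, x), z)].

(* [G] is the graph of an injection of [dom G * dom G] into [dom G]. *)
Let sq (G : set ((W * W) * W)) : Prop :=
  [/\ forall x y z, G ((x, y), z) -> [/\ dom G x, dom G y & dom G z],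
      forall x y, dom G x -> dom G y -> exists z, G ((x, y), z) &
      forall u v z, G (u, z) -> G (v, z) -> u = v].

(** The seed of the Zorn argument: pairs in the image of [nat] are coded by [pickle]. It also puts
    [h 0] and [h 1] in the domain, where they serve as tags. *)
Let G0 : set ((W * W) * W) :=
  [set t | exists i j, t = ((h i, h j), h (pickle (i, j)))].

Let sq_G0 : sq G0.
Proof.
have dG0 i : dom G0 (h i) by exists (h (pickle (i, i))), i, i.
split.
- by move=> x y z [i [j [-> -> ->]]].
- by move=> x y [_ [i [_ [-> _ _]]]] [_ [j [_ [-> _ _]]]];
    exists (h (pickle (i, j))), i, j.
- move=> u v z [i [j [-> ->]]] [i' [j' [-> /hinj]]].
  by move=> /(pcan_inj pickleK)[-> ->].
Qed.

Let dom_sub (G G' : set ((W * W) * W)) : G `<=` G' -> dom G `<=` dom G'.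
Proof. by move=> GG' x [z /GG' Gz]; exists z. Qed.

Let sq_max : exists G, [/\ sq G, dom G (h 0%N), dom G (h 1%N) &
  forall G', sq G' -> G `<=` G' -> G' `<=` G].
Proof.
(* Adding [G0] inside the predicate takes care of the empty chain and makes the maximal graph extend
   the seed. *)
have [F FP Ftot|G [sqG Gmax]] := @Zorn_bigcup _ [set G | sq (G0 `|` G)].
  change (sq (G0 `|` \bigcup_(X in F) X)).
  have [->|/set0P[X0 FX0]] := eqVneq F set0.
    by rewrite bigcup_set0 setU0; exact: sq_G0.
  set H := G0 `|` _.
  have sub X : F X -> G0 `|` X `<=` H.
    by move=> FX t [?|?]; [left|right; exists X].
  have HX t : H t -> exists2 X, F X & (G0 `|` X) t.
    by move=> [?|[X FX Xt]]; [exists X0 => //; left|exists X => //; right].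
  have HX2 t u : H t -> H u -> exists2 X, F X & (G0 `|` X) t /\ (G0 `|` X) u.
    move=> /HX[X FX Xt] /HX[Y FY Yu]; have [XY|YX] := Ftot _ _ FX FY.
      by exists Y => //; split=> //; move: Xt => [|/XY]; [left|right].
    by exists X => //; split=> //; move: Yu => [|/YX]; [left|right].
  split.
  - move=> x y z /HX[X FX]; have [S1 _ _] := FP _ FX.
    by move=> /S1[? ? ?]; split; exact: (dom_sub (sub X FX)).
  - move=> x y [z Hx] [w Hy]; have [X FX [Xx Xy]] := HX2 _ _ Hx Hy.
    have [_ S2 _] := FP _ FX.
    have [||v Xv] := S2 x y; [by exists z|by exists w|].
    by exists v; exact: sub Xv.
  - move=> u v z Hu Hv; have [X FX [Xu Xv]] := HX2 _ _ Hu Hv.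
    by have [_ _ S3] := FP _ FX; exact: S3 Xu Xv.
have dG i : dom (G0 `|` G) (h i).
  by exists (h (pickle (i, i))); left; exists i, i.
exists (G0 `|` G); split=> // G' sqG' GG' t G't.
apply: contrapT => nt; apply: (Gmax G'); last first.
  by rewrite /= (_ : _ `|` _ = G')//; apply/seteqP; split=> [u [?|//]|]; [apply: GG'; left|right].
split=> [u Gu|/(_ _ G't) ?]; first by apply: GG'; right.
by apply: nt; right.
Qed.

(** Let [D] be the domain of a maximal graph. If [D] injected into its complement, the graph could
    be extended to [D] and a disjoint copy of it. So the complement injects into [D]; then [W]
    injects into two tagged copies of [D] inside [D], and pairs can be coded there. *)
Lemma square_inj : exists f : W * W -> W, injective f.
Proof.
have [G [[S1 S2 S3] d0 d1 Gmax]] := sq_max.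
pose D := dom G.
have /choice[f0 f0G] : forall xy : W * W, exists z, D xy.1 -> D xy.2 -> G (xy, z).
  move=> [x y]; have [Dx|?] := pselect (D x); last by exists (h 0%N).
  have [Dy|?] := pselect (D y); last by exists (h 0%N).
  by have [z ?] := S2 _ _ Dx Dy; exists z.
pose f x y := f0 (x, y).
have fD x y : D x -> D y -> D (f x y).
  by move=> Dx Dy; have /S1[] := f0G (x, y) Dx Dy.
have finj x y x' y' : D x -> D y -> D x' -> D y' -> f x y = f x' y' -> x = x' /\ y = y'.
  move=> Dx Dy Dx' Dy' e; have := f0G (x', y') Dx' Dy'.
  by rewrite -/(f x' y') -e => /(S3 _ _ _ (f0G (x, y) Dx Dy))[].
have [[j jinj]|[j jinj]] :=
    card_trichotomy {x | ~ D x} {x | D x}; last first.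
  have /choice[k kP] : forall x, exists z, forall Dx : D x, z = sval (j (exist _ x Dx)).
    move=> x; have [Dx|?] := pselect (D x); last by exists x.
    by exists (sval (j (exist _ x Dx))) => Dx'; rewrite (Prop_irrelevance Dx Dx').
  have kD x : D x -> ~ D (k x) by move=> Dx; rewrite (kP x Dx); case: (j _).
  have kinj x y : D x -> D y -> k x = k y -> x = y.
    move=> Dx Dy; rewrite (kP x Dx) (kP y Dy) => e.
    have /jinj[] // : j (exist _ x Dx) = j (exist _ y Dy).
    by case: (j _) (j _) e => [u ?] [v ?] /= e; exact: eq_exist.
  (* The tag [b] tells the original [D] from its copy under [k]. *)
  pose s (b : bool) x := if b then k x else x.
  have sD b x : D x -> D (s b x) <-> b = false.
    by move=> Dx; case: b => //=; split=> // /(kD _ Dx).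
  have sinj b b' x x' : D x -> D x' -> s b x = s b' x' -> b = b' /\ x = x'.
    move=> Dx Dx' e; have bb : b = b'.
      have := sD b x Dx; rewrite e; have := sD b' x' Dx'.
      by case: b b' {e} => [] [] // [H1 H2] [H3 H4]; [have := H3 (H2 erefl)|have := H1 (H4 erefl)].
    by split=> //; move: e; rewrite -bb; case: (b) => //= /kinj; exact.
  (* New pairs, those with an entry in the copy, are sent into the copy; the tags [h b] and [h b']
     record which entries lie there. *)
  pose g (b b' : bool) x y := k (f (h b) (f (h b') (f x y))).
  have hD (b : bool) : D (h b) by case: b.
  have gD (b b' : bool) x y : D x -> D y -> D (f (h b) (f (h b') (f x y))).
    by move=> Dx Dy; exact: fD _ _ (hD _) (fD _ _ (hD _) (fD _ _ Dx Dy)).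
  pose G' := [set t | exists b b' x y, [/\ b || b', D x, D y & t = ((s b x, s b' y), g b b' x y)]].
  have dom' x : dom (G `|` G') x <-> exists b x0, D x0 /\ x = s b x0.
    split=> [[z [/S1[]|]]|[[] [x0 [Dx0 ->]]]].
    - by exists false, x.
    - by move=> [b [b' [x0 [y0 [_ ? _ [-> _]]]]]]; exists b, x0.
    - by exists (g true true x0 x0); right; exists true, true, x0, x0.
    - by have [z Gz] := Dx0; exists z; left.
  have /Gmax : sq (G `|` G').
    split.
    - move=> x y z [/S1[? ? ?]|[b [b' [x0 [y0 [_ ? ? [-> -> ->]]]]]]].
        by split; apply/dom'; [exists false, x|exists false, y|exists false, z].
      split; apply/dom'; [by exists b, x0|by exists b', y0|exists true].
      by exists (f (h b) (f (h b') (f x0 y0))); split=> //; exact: gD.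
    - move=> _ _ /dom'[b [x [Dx ->]]] /dom'[b' [y [Dy ->]]].
      have [bb|] := boolP (b || b').
        by exists (g b b' x y); right; exists b, b', x, y.
      case: b b' => [] [] // _; exists (f x y); left; exact: (f0G (x, y)).
    - move=> u v z [Gu|[b [b' [x [y [bb Dx Dy [-> ->]]]]]]] [Gv|].
      + exact: S3 Gu Gv.
      + move=> [b [b' [x [y [bb Dx Dy [_ ez]]]]]]; exfalso.
        move: Gu; rewrite ez; case: (u) => p q /S1[_ _].
        by apply: kD; exact: gD.
      + exfalso; move: Gv; case: (v) => p q /S1[_ _].
        by apply: kD; exact: gD.
      + move=> [c [c' [x' [y' [cc Dx' Dy' [-> ez]]]]]].
        have D1 (c0 : bool) x0 y0 : D x0 -> D y0 -> D (f (h c0) (f x0 y0)).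
          by move=> D0 D0'; exact: fD _ _ (hD _) (fD _ _ D0 D0').
        move: ez => /(kinj _ _ (gD _ _ _ _ Dx Dy) (gD _ _ _ _ Dx' Dy')).
        move=> /(finj _ _ _ _ (hD _) (D1 _ _ _ Dx Dy) (hD _) (D1 _ _ _ Dx' Dy'))[].
        move=> /hinj ebc /(finj _ _ _ _ (hD _) (fD _ _ Dx Dy) (hD _) (fD _ _ Dx' Dy'))[].
        move=> /hinj ebc' /(finj _ _ _ _ Dx Dy Dx' Dy')[-> ->].
        have -> : b = c by case: (b) (c) ebc => [] [].
        by have -> : b' = c' by case: (b') (c') ebc' => [] [].
  move=> /(_ (@subsetUl _ _ _)).
  move=> Gsub.
  have /S1[/(kD _ d0)//] : G ((k (h 0%N), k (h 0%N)), g true true (h 0%N) (h 0%N)).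
  by apply: Gsub; right; exists true, true, (h 0%N), (h 0%N).
(* Points of [D] are tagged by [h 0], and points outside, moved into [D] by [j], by [h 1]. *)
have [k kD kinj] : exists2 k : W -> W, forall x, D (k x) & injective k.
  have /choice[k kP] : forall x, exists z,
      (forall Dx : ~ D x, z = f (h 1%N) (sval (j (exist _ x Dx)))) /\
      (D x -> z = f (h 0%N) x).
    move=> x; have [Dx|nDx] := pselect (D x).
      by exists (f (h 0%N) x).
    exists (f (h 1%N) (sval (j (exist _ x nDx)))); split=> // Dx'.
    by rewrite (Prop_irrelevance nDx Dx').
  have kD0 x : D x -> k x = f (h 0%N) x by case: (kP x).
  have kD1 x (nDx : ~ D x) : k x = f (h 1%N) (sval (j (exist _ x nDx))) by case: (kP x).
  exists k => [x|x y].
    have [Dx|nDx] := pselect (D x); first by rewrite kD0//; exact: fD.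
    by rewrite kD1; apply: (fD) => //; case: (j _).
  have [Dx|nDx] := pselect (D x); have [Dy|nDy] := pselect (D y).
  - by rewrite !kD0// => /finj[].
  - by rewrite kD0// kD1 => /finj[]//; [case: (j _)|move=> /hinj].
  - by rewrite kD1 kD0// => /finj[]//; [case: (j _)|move=> /hinj].
  - rewrite !kD1 => /finj[]//; do ?by case: (j _).
    move=> _ e; have /jinj[] // : j (exist _ x nDx) = j (exist _ y nDy).
    by case: (j _) (j _) e => [u ?] [v ?] /= e; exact: eq_exist.
exists (fun xy => f (k xy.1) (k xy.2)) => -[x y] [x' y'] /=.
by move=> /(finj _ _ _ _ (kD _) (kD _) (kD _) (kD _))[] /kinj -> /kinj ->.
Qed.

End Square.

(** * Arithmetic of small types *)

Section Small.
Variables (K : Type) (K_nat : small K [set: nat]).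

Lemma small_le (V W : Type) (A : set V) (B : set W) :
  (A #<= B)%card -> small K B -> small K A.
Proof.
move=> AB [BK KB]; split; first exact: card_le_trans AB BK.
by move=> KA; apply: KB; exact: card_le_trans KA AB.
Qed.

Lemma small_inj (V W : Type) (f : V -> W) :
  injective f -> small K [set: W] -> small K [set: V].
Proof. by move=> finj; apply: small_le; apply/card_leTP; exists f. Qed.

Lemma small_surj (V W : Type) (f : V -> W) :
  (forall w, exists v, f v = w) -> small K [set: V] -> small K [set: W].
Proof.
move=> /choice[g fg]; apply: (@small_inj _ _ g) => w w' e.
by rewrite -(fg w) e fg.
Qed.

(** The largest of [V], [W] and [nat] is small and infinite, so [square_inj] applies to it;
    products, sums and sequences are then coded inside it. *)
Lemma small_common (V W : Type) :
  small K [set: V] -> small K [set: W] -> exists Z : Type,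
  [/\ small K [set: Z], exists f : V -> Z, injective f,
      exists f : W -> Z, injective f & exists f : nat -> Z, injective f].
Proof.
have idinj Y : exists f : Y -> Y, injective f by exists id.
have compinj (A B C : Type) : (exists f : A -> B, injective f) ->
    (exists f : B -> C, injective f) -> exists f : A -> C, injective f.
  by move=> [f fi] [g gi]; exists (g \o f); exact: inj_comp.
move=> sV sW.
have [VW|WV] := card_trichotomy V W.
  have [Wn|nW] := card_trichotomy W nat; last by exists W.
  by exists nat; split=> //; exact: compinj VW Wn.
have [Vn|nV] := card_trichotomy V nat; last by exists V.
by exists nat; split=> //; exact: compinj WV Vn.
Qed.

Lemma small_prod (V W : Type) :
  small K [set: V] -> small K [set: W] -> small K [set: (V * W)%type].
Proof.
move=> sV sW; have [Z [sZ [f finj] [g ginj] [h hinj]]] := small_common sV sW.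
have [q qinj] := square_inj hinj.
apply: (@small_inj _ _ (fun vw => q (f vw.1, g vw.2))) sZ => -[v w] [v' w'] /=.
by move=> /qinj[/finj -> /ginj ->].
Qed.

Lemma small_sum (V W : Type) :
  small K [set: V] -> small K [set: W] -> small K [set: (V + W)%type].
Proof.
move=> sV sW; have [Z [sZ [f finj] [g ginj] _]] := small_common sV sW.
apply: (@small_inj _ _ (fun x : V + W => match x with
   inl v => (0%N, f v) | inr w => (1%N, g w) end)) (small_prod K_nat sZ).
by move=> [v|w] [v'|w'] // [] => [/finj|/ginj] ->.
Qed.

Lemma small_seq (V : Type) : small K [set: V] -> small K [set: seq V].
Proof.
move=> sV; have [Z [sZ [f finj] _ [h hinj]]] := small_common sV sV.
have [q qinj] := square_inj hinj.
pose fix code (s : seq V) :=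
  if s is x :: s' then q (h 1%N, q (f x, code s')) else q (h 0%N, h 0%N).
apply: (@small_inj _ _ code) sZ; elim=> [|x s IH] [|y t] //=.
- by move=> /qinj[/hinj].
- by move=> /qinj[/hinj].
- by move=> /qinj[/qinj[/finj -> /IH ->]].
Qed.

Lemma small_tuple (n : nat) (X : 'I_n -> Type) :
  (forall i, small K [set: X i]) -> small K [set: tuple_vars X].
Proof.
elim: n X => [|n IH] X sX.
  by apply: small_le K_nat; apply/card_leTP; exists (fun=> 0%N) => -[[]].
apply: (@small_surj (X ord0 + tuple_vars (fun i => X (lift ord0 i))) _ (fun z =>
  match z with inl x => existT X ord0 x
  | inr y => existT X (lift ord0 (projT1 y)) (projT2 y) end)).
  move=> [i x]; case: (unliftP ord0 i) x => [j|] -> x; last by exists (inl x).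
  by exists (inr (existT _ j x)).
by apply: small_sum => //; exact: IH.
Qed.

Lemma small_setT (V : Type) (A : set V) : small K [set: A] <-> small K A.
Proof.
by move: (card_setT A) => /card_eqPle[AT TA]; split; exact: small_le.
Qed.

Lemma small_range (V W : Type) (e : V -> W) :
  small K [set: V] -> small K (range e).
Proof. by apply: small_le; exact: card_image_le. Qed.

Lemma small_setU (V : Type) (A B : set V) :
  small K A -> small K B -> small K (A `|` B).
Proof.
move=> /small_setT sA /small_setT sB.
apply: (@small_le _ _ _ (range (copair (fun a : A => val a) (fun b : B => val b)))).
  apply: subset_card_le => x [Ax|Bx].
    by exists (inl (SigSub (mem_set Ax))).
  by exists (inr (SigSub (mem_set Bx))).
by apply: small_range; exact: small_sum.
Qed.

Lemma small_finite (V : Type) (A : set V) : finite_set A -> small K A.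
Proof. by move=> /finite_set_countable/small_le; apply. Qed.
End Small.

(** * Saturation of the monster model *)

Section CountFormulas.
Variable L : language.

Let sym : Type := (nat + Defs.fsym L + rsym L)%type.

Fixpoint term_code (V : Type) (e : V -> nat) (t : term L V) : GenTree.tree sym :=
  match t with
  | Var v => GenTree.Leaf (inl (inl (e v)))
  | App f ts => GenTree.Node 0 (GenTree.Leaf (inl (inr f)) ::
      [seq term_code e (ts i) | i <- enum 'I_(farity f)])
  end.

(** Under a quantifier the bound variable gets number 0 and the others are shifted, which keeps the
    numbering of variables injective. *)
Fixpoint formula_code (V : Type) (e : V -> nat) (phi : formula L V) :
    GenTree.tree sym :=
  match phi with
  | Bot => GenTree.Node 0 [::]
  | Eq t u => GenTree.Node 1 [:: term_code e t; term_code e u]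
  | Rel r ts => GenTree.Node 2 (GenTree.Leaf (inr r) ::
      [seq term_code e (ts i) | i <- enum 'I_(rarity r)])
  | Imp phi psi => GenTree.Node 3 [:: formula_code e phi; formula_code e psi]
  | All phi => GenTree.Node 4 [:: formula_code (oapp (S \o e) 0%N) phi]
  end.

Let term_code_inj (V : Type) (e : V -> nat) : injective e -> injective (term_code e).
Proof.
move=> einj; elim=> [v|f ts IH] [w|f' ts'] //=; first by move=> [/einj ->].
move=> [ff']; subst f' => /eq_in_map H; congr App; apply/funext => i.
by apply: IH; apply: H; rewrite mem_enum.
Qed.

Let formula_code_inj (V : Type) (phi : formula L V) : forall (e : V -> nat),
  injective e -> forall psi, formula_code e phi = formula_code e psi -> phi = psi.
Proof.
elim: phi => {V}.
- by move=> V e _ [].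
- by move=> V t u e einj [] // t' u' [] /(term_code_inj einj)-> /(term_code_inj einj)->.
- move=> V r ts e einj [] // r' ts' [] rr'; subst r' => /eq_in_map H.
  congr Rel; apply/funext => i.
  by apply: (term_code_inj einj); apply: H; rewrite mem_enum.
- move=> V phi IH1 psi IH2 e einj [] // phi' psi' [].
  by move=> /(IH1 _ einj)-> /(IH2 _ einj)->.
- move=> V phi IH e einj [] // phi' []; move=> /IH -> //.
  by move=> [x|] [y|] // [/einj ->].
Qed.

(** A formula is a finite tree with symbols and numbers as leaves, hence a finite sequence over a
    small type. The variable [None] is the one for which a Skolem function will be chosen. *)
Lemma small_formula (K : Type) : small K [set: nat] -> small K [set: Defs.fsym L] ->
  small K [set: rsym L] ->
  small K [set: {k : nat & formula L (option 'I_k)}].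
Proof.
move=> Kn Kf Kr.
pose env k : option 'I_k -> nat := oapp (fun i : 'I_k => (val i).+1) 0%N.
have envi k : injective (@env k) by move=> [x|] [y|] //= [/val_inj ->].
apply: (@small_inj _ _ _ (fun s => (projT1 s,
   GenTree.encode (formula_code (@env (projT1 s)) (projT2 s))))).
  move=> [k phi] [k' phi'] /= [kk']; subst k'.
  by move=> /(pcan_inj (@GenTree.codeK _))/formula_code_inj ->.
apply: small_prod => //; apply: small_seq => //; apply: small_sum => //.
by do 2![apply: small_sum => //].
Qed.
End CountFormulas.

Section Automorphism.
Variables (L : language) (M : structure L).

Lemma automorphism_sat (s : M -> M) : automorphism s ->
  forall (V : Type) (phi : formula L V) (e : V -> M),
  sat e phi <-> sat (s \o e) phi.
Proof.
move=> [[s' sK s'K] sf sr].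
have steval V (e : V -> M) t : s (teval e t) = teval (s \o e) t.
  by elim: t => //= f ts IH; rewrite sf; congr finterp; apply/funext => i; exact: IH.
move=> V phi; elim: phi => {V} /=.
- by [].
- by move=> V t u e; rewrite -!steval; split=> [->//|/(can_inj sK)].
- move=> V r ts e; rewrite sr; suff -> : s \o (fun i => teval e (ts i)) =
    (fun i => teval (s \o e) (ts i)) by [].
  by apply/funext => i; exact: steval.
- by move=> V phi IH1 psi IH2 e; rewrite (propext (IH1 e)) (propext (IH2 e)).
- move=> V phi IH e.
  have oE a : s \o oapp e a = oapp (s \o e) (s a) by apply/funext => -[].
  split=> H a; first by rewrite -(s'K a) -oE -(propext (IH _)).
  by rewrite (propext (IH _)) oE.
Qed.

Lemma elementary_embedding_sat (N : structure L) (h : M -> N) :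
  elementary_embedding h ->
  forall (V : Type) (phi : formula L V) (e : V -> M),
  sat e phi <-> sat (h \o e) phi.
Proof.
move=> hel V phi e.
have [k [v vE]] := finite_set_ord (fvars_finite phi).
have [w|phi0 <- _] := @frename_lift L V phi 'I_k v setT; last by rewrite !sat_rename hel.
by rewrite -vE => -[i _ <-]; exists i.
Qed.
End Automorphism.

Section Saturation.
Variables (L : language) (U : structure L).

(** * Skolem hulls modulo an ultrafilter *)

Section SkolemHull.
Variables (V C : Type) (c0 : C -> U) (F : set_system (V -> U)).
Context {FF : UltraFilter F}.

Let FP : ProperFilter F := ultra_proper.

Let FI A B : F A -> F B -> F (A `&` B).
Proof. exact: filterI. Qed.

Lemma ultra_const (P : Prop) : F [set _ | P] <-> P.
Proof.
split=> [FPP|p]; first by have [] := filter_ex FPP.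
by apply: filterS filterT.
Qed.

Lemma ultra_imp (P Q : (V -> U) -> Prop) :
  F [set a | P a -> Q a] <-> (F [set a | P a] -> F [set a | Q a]).
Proof.
split=> [FPQ FPP|H]; first by apply: filterS2 FPQ FPP => a; exact.
have [/H|] := in_ultra_setVsetC [set a | P a] FF.
  by apply: filterS => a Qa _.
by apply: filterS => a nPa /nPa.
Qed.

(* Terms in the constants [V + C] and one Skolem function for every formula;
   the choice of an element of [U] for each variable in [V] evaluates them. *)
Inductive skterm : Type :=
| SkConst of V + C
| SkApp (s : {k : nat & formula L (option 'I_k)}) of
    ('I_(projT1 s) -> skterm).

(** Arity, formula and arguments are packed into one type so that a single use of choice suffices;
    an arbitrary element of [U] is the value when there is no witness. *)
Lemma skolem_fun : exists g : forall k, formula L (option 'I_k) -> ('I_k -> U) -> U,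
  forall k (phi : formula L (option 'I_k)) x y,
    sat (oapp x y) phi -> sat (oapp x (g k phi x)) phi.
Proof.
have H (t : {k : nat & formula L (option 'I_k) * ('I_k -> U)}%type) :
    exists z, forall y, sat (oapp (projT2 t).2 y) (projT2 t).1 ->
      sat (oapp (projT2 t).2 z) (projT2 t).1.
  have [[z ?]|/forallNP n] := pselect (exists y, sat (oapp (projT2 t).2 y) (projT2 t).1).
    by exists z.
  by have [z] := domain_inh U; exists z => y /n.
have [g gP] := choice H.
exists (fun k phi x => g (existT _ k (phi, x))) => k phi x y.
exact: (gP (existT _ k (phi, x))).
Qed.

Let skf := projT1 (cid skolem_fun).
Let skfP := projT2 (cid skolem_fun).

Fixpoint skeval (a : V -> U) (c : skterm) : U :=
  match c with
  | SkConst v => copair a c0 v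
  | SkApp s cs => skf (projT2 s) (fun i => skeval a (cs i))
  end.

Let eqv (c c' : skterm) : Prop := F [set a | skeval a c = skeval a c'].

Let eqv_refl c : eqv c c.
Proof. by apply: filterS filterT. Qed.

Let eqv_sym c c' : eqv c c' -> eqv c' c.
Proof. exact: filterS. Qed.

Let eqv_trans c1 c2 c3 : eqv c1 c2 -> eqv c2 c3 -> eqv c1 c3.
Proof. by apply: filterS2 => a /= -> . Qed.

(** This is the part of the ultrapower of [U] along [F] formed by the functions sending [a] to
    [skeval a c]. Unlike the full ultrapower, it is small when [V] and [C] are. *)
Definition hull_dom : Type := {A : set skterm | exists c, A = eqv c}.

Definition hull_class (c : skterm) : hull_dom :=
  exist _ (eqv c) (ex_intro _ c erefl).

Lemma hull_class_eq c c' : hull_class c = hull_class c' <-> eqv c c'.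
Proof.
split=> [[ee]|cc']; first by rewrite ee; exact: eqv_refl.
apply: eq_exist; apply/funext => d; apply/propext; split.
  exact/eqv_trans/eqv_sym.
exact: eqv_trans.
Qed.

Lemma hull_class_surj x : exists c, hull_class c = x.
Proof. by case: x => A [c ec]; exists c; apply: eq_exist. Qed.

Let rep x := projT1 (cid (hull_class_surj x)).
Let repK x : hull_class (rep x) = x := projT2 (cid (hull_class_surj x)).

(** A function symbol is recovered as the Skolem function of the formula $f(x)=y$. *)
Let sk_app (f : Defs.fsym L) (cs : 'I_(farity f) -> skterm) : skterm :=
  @SkApp (existT (fun k => formula L (option 'I_k)) (farity f)
    (Eq (App (fun i => Var L (Some i))) (Var L None))) cs.

Let skeval_app a f (cs : 'I_(farity f) -> skterm) :
  skeval a (sk_app cs) = finterp (fun i => skeval a (cs i)).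
Proof.
set x := fun i => skeval a (cs i).
exact/esym/(@skfP (farity f) (Eq (App (fun i => Var L (Some i))) (Var L None)) x
  (finterp x) erefl).
Qed.

Lemma hull_inh : inhabited hull_dom.
Proof.
apply: inhabits; apply: hull_class.
(* A Skolem function without arguments gives a term even when [V] and [C] are empty. *)
by apply: (@SkApp (existT (fun k => formula L (option 'I_k)) 0%N Bot)) => -[].
Qed.

Definition hull : structure L :=
  @Structure L hull_dom hull_inh
    (fun f xs => hull_class (sk_app (fun i => rep (xs i))))
    (fun r xs => F [set a | rinterp (fun i => skeval a (rep (xs i)))]).

Let los_term (W : Type) (e : W -> skterm) (t : term L W) : forall c,
  hull_class c = teval (M := hull) (hull_class \o e) t ->
  F [set a | skeval a c = teval (skeval a \o e) t].
Proof.
elim: t => [w|f ts IH] c /=; first by move/hull_class_eq.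
pose xs i := teval (M := hull) (hull_class \o e) (ts i).
move=> /hull_class_eq H.
have /filter_forall : forall i, F [set a | skeval a (rep (xs i)) = teval (skeval a \o e) (ts i)].
  by move=> i; exact: IH.
apply: filterS2 H => a E {}H; rewrite /= (etrans E (skeval_app _ _)).
by congr finterp; apply/funext => i; exact: H.
Qed.

(** The theorem of Los survives the passage from the full ultrapower to the hull, because the hull
    contains the Skolem witnesses. *)
Lemma los (W : Type) (phi : formula L W) : forall e : W -> skterm,
  sat (M := hull) (hull_class \o e) phi <-> F [set a | sat (skeval a \o e) phi].
Proof.
elim: phi => {W} /=.
- by move=> W e; split=> // /(@filter_ex _ _ FP)[].
- move=> W t u e.
  set x : hull_dom := teval (M := hull) _ t; set y : hull_dom := teval (M := hull) _ u.
  have Hx := los_term (repK x); have Hy := los_term (repK y).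
  have -> : (x = y) = eqv (rep x) (rep y).
    by apply/propext; rewrite -hull_class_eq !repK.
  have {Hx Hy} Hxy := FI Hx Hy.
  by split=> H; have := FI Hxy H; apply: filterS => a [[/= -> ->]].
- move=> W r ts e; pose xs i := teval (M := hull) (hull_class \o e) (ts i).
  have /filter_forall H : forall i,
      F [set a | skeval a (rep (xs i)) = teval (skeval a \o e) (ts i)].
    by move=> i; exact: los_term.
  have E : F [set a | (fun i => skeval a (rep (xs i))) = (fun i => teval (skeval a \o e) (ts i))].
    by apply: filterS H => a H; apply/funext => i; exact: H.
  by split; apply: filterS2 E => a /= ->.
- by move=> W phi IH1 psi IH2 e; rewrite IH1 IH2 ultra_imp.
- move=> W phi IH e.
  have oE a c : skeval a \o oapp e c = oapp (skeval a \o e) (skeval a c).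
    by apply/funext => -[].
  have oE' c : hull_class \o oapp e c = oapp (hull_class \o e) (hull_class c).
    by apply/funext => -[].
  split=> H; last first.
    move=> x; rewrite -(repK x) -oE'; apply/IH.
    by apply: filterS H => a Ha /=; rewrite oE.
  (* If the universal statement fails for almost all [a], the Skolem term of the negation is one
     element of the hull refuting it for almost all [a]. A Skolem function has finitely many
     arguments, so [phi] is first pulled back to its free variables. *)
  have [//|nH] := in_ultra_setVsetC [set a | forall y, sat (oapp (skeval a \o e) y) phi] FF.
  have [k [v vE]] : exists k (v : 'I_k -> W), range v = fvars (All phi).
    exact/finite_set_ord/fvars_finite.
  have [[w pw|_]|phi0 ephi _] := @frename_lift L _ phi (option 'I_k) (omap v) setT.
  + have [i _ <-] : range v w by rewrite vE.
    by exists (Some i).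
  + by exists None.
  pose c := @SkApp (existT (fun k => formula L (option 'I_k)) k (Neg phi0)) (e \o v).
  have := H (hull_class c); rewrite -oE' IH => Hc.
  have [a [/= na]] := @filter_ex _ _ FP _ (FI nH Hc).
  rewrite oE -ephi sat_rename; case/existsNP: na => y ny.
  have oEv z : oapp (skeval a \o e) z \o omap v = oapp (skeval a \o (e \o v)) z.
    by apply/funext => -[].
  move: ny; rewrite -ephi sat_rename !oEv => ny sa.
  by have := @skfP k (Neg phi0) _ y ny; case.
Qed.

Lemma small_hull (K : Type) : small K [set: nat] -> small K [set: Defs.fsym L] ->
  small K [set: rsym L] -> small K [set: V] -> small K [set: C] ->
  small K [set: hull].
Proof.
move=> Kn Kf Kr KV KC; apply: (small_surj hull_class_surj).
pose fix code (c : skterm) :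
    GenTree.tree ((V + C) + {k : nat & formula L (option 'I_k)}) :=
  match c with
  | SkConst v => GenTree.Leaf (inl v)
  | SkApp s cs => GenTree.Node 0 (GenTree.Leaf (inr s) ::
      [seq code (cs i) | i <- enum 'I_(projT1 s)])
  end.
have code_inj : injective code.
  elim=> [v|s cs IH] [w|s' cs'] //=; first by move=> [->].
  move=> [ss']; subst s' => /eq_in_map H; congr SkApp; apply/funext => i.
  by apply: IH; apply: H; rewrite mem_enum.
apply: (@small_inj _ _ _ (@GenTree.encode _ \o code)).
  by apply: inj_comp => //; exact: pcan_inj (@GenTree.codeK _).
apply/(small_seq Kn)/(small_sum Kn Kn)/(small_sum Kn (small_sum Kn KV KC)).
exact: small_formula.
Qed.

End SkolemHull.

Variables (T : theory L) (K : Type) (U_monster : monster T K U).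

Lemma saturation (V : Type) (D : set U) (Sigma : set (formula L (V + U))) :
  small K [set: V] -> small K D -> (forall phi, Sigma phi -> params phi `<=` D) ->
  (forall F, finite_set F -> F `<=` Sigma ->
     exists a : V -> U, forall phi, F phi -> sat (copair a id) phi) ->
  exists a : V -> U, forall phi, Sigma phi -> sat (copair a id) phi.
Proof.
move=> KV KD SD Sfin.
have [Umod Uuniv Uhom Kn Kf Kr] := U_monster.
(* The filter generated by the solution sets of finite parts of [Sigma]; in the hull along an
   ultrafilter extending it, the classes of the variables realize [Sigma]. *)
pose F0 : set_system (V -> U) := [set A | exists F, [/\ finite_set F, F `<=` Sigma &
  [set a | forall phi, F phi -> sat (copair a id) phi] `<=` A]].
have F0P : ProperFilter F0.
  apply: Build_ProperFilter_ex => [A [F [Ffin FS FA]]|].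
    by have [a Ha] := Sfin F Ffin FS; exists a; exact: FA.
  split=> [|A B [F [Ffin FS FA]] [G [Gfin GS GB]]|A B AB [F [Ffin FS FA]]].
  - by exists set0; split; [exact: finite_set0|exact: sub0set|].
  - exists (F `|` G); split; [by rewrite finite_setU|by rewrite subUset|].
    by move=> a Ha; split; [apply: FA|apply: GB] => phi ?; apply: Ha; [left|right].
  - by exists F; split=> //; exact: subset_trans AB.
have [F [FU FF0]] := ultraFilterLemma F0P.
have FP : ProperFilter F := ultra_proper.
pose c0 (d : D) : U := val d.
pose N := hull c0 F; pose cls := @hull_class V D c0 F.
have NT : models N T.
  move=> s Ts; rewrite /holds (_ : of_void N = cls \o of_void _); last by apply/funext => -[].
  apply/los; apply: filterS filterT => a _ /=.
  by have := Umod s Ts; rewrite /holds; congr sat; apply/funext => -[].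
have [h hel] := Uuniv N NT (small_hull c0 F Kn Kf Kr KV ((small_setT K D).2 KD)).
have {}hel (W : Type) (phi : formula L W) e :
    sat (h \o (cls \o e)) phi <-> F [set a | sat (skeval c0 a \o e) phi].
  by rewrite -(elementary_embedding_sat hel); exact: los.
(* The embedding given by universality may move [D]. The constants from [D] do not depend on the
   assignment, so [f] is partial elementary, and homogeneity extends it to an automorphism, whose
   inverse brings the realization back. *)
pose f (d : D) : U := h (cls (SkConst (inr d))).
have [s [s_aut sf]] : exists s : U -> U, automorphism s /\ forall d : D, s (val d) = f d.
  apply: Uhom KD _ => phi.
  apply: iff_trans (iff_sym (hel _ phi (fun d => SkConst (inr d)))).
  apply: iff_sym; exact: ultra_const.
have [[s' sK s'K] _ _] := s_aut.
exists (fun v => s' (h (cls (SkConst (inl v))))) => phi Sphi.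
have [[v _|u /SD Du]|psi psiE _] := @frename_lift L _ phi (V + D)
    (copair inl (fun d : D => inr (val d))) setT.
- by exists (inl v).
- by exists (inr (SigSub (mem_set (Du Sphi)))).
rewrite -psiE sat_rename; apply: (automorphism_sat s_aut _ _).2.
set e := (e in sat e _).
have -> : e = h \o (cls \o (fun vd => SkConst vd)).
  by apply/funext => -[v|d]; rewrite /e /= ?s'K ?sf.
apply/hel; apply: FF0; exists [set phi]; split=> [||a /(_ phi erefl)].
- exact: finite_set1.
- by move=> _ ->.
- rewrite -psiE sat_rename /=; congr sat.
  by apply/funext => -[].
Qed.

End Saturation.

(** * Realizations of global types *)

Section TypesOverU.
Variables (L : language) (U : structure L).

Lemma complete_type_neg (X : Type) (p : set (formula L (X + U))) phi :
  complete_type p -> p (Neg phi) <-> ~ p phi.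
Proof.
move=> [pfin pc]; split=> [pn pp|np]; last by case: (pc phi).
have [||a Ha] := pfin [set phi; Neg phi]; [exact: finite_set2|by move=> _ [] ->|].
by apply: (Ha (Neg phi)); [right|apply: Ha; left].
Qed.

(** Formulas keep their parameters in [U] and only the parameters that occur are bounded; so
    changing [D] requires no renaming. The link with [realizes] is [realizes_restr]. *)
Definition realizes_over (X : Type) (p : set (formula L (X + U))) (D : set U)
    (a : X -> U) : Prop :=
  forall phi, params phi `<=` D -> p phi -> sat (copair a id) phi.

Lemma realizes_over_sub (X : Type) (p : set (formula L (X + U))) (D D' : set U) a :
  D `<=` D' -> realizes_over p D' a -> realizes_over p D a.
Proof. by move=> DD' H phi pD; apply: H; exact: subset_trans DD'. Qed.

Lemma realizes_overE (X : Type) (p : set (formula L (X + U))) (D : set U) a phi :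
  complete_type p -> realizes_over p D a -> params phi `<=` D ->
  p phi <-> sat (copair a id) phi.
Proof.
move=> pc H pD; split=> [|s]; first exact: H.
apply: contrapT => /(complete_type_neg _ pc) /H; apply=> //.
by move=> u [|]//; exact: pD.
Qed.

Lemma realizes_restr (X : Type) (p : set (formula L (X + U))) (D : set U) a :
  realizes (restr (C := D) p) a <-> realizes_over p D a.
Proof.
have cE : copair a id \o copair inl (fun u : D => inr (val u)) =
    copair a (fun u : D => val u) by apply/funext => -[].
split=> H phi.
  move=> pD pp; have [[x _|u /pD Du]|psi psiE _] := @frename_lift L _ phi (X + D)
    (copair inl (fun u : D => inr (val u))) setT.
  - by exists (inl x).
  - by exists (inr (SigSub (mem_set Du))).
  by rewrite -psiE sat_rename cE; apply: H; rewrite /restr /= psiE.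
rewrite /restr /= => pp; rewrite -cE -sat_rename; apply: H => // u.
by rewrite /params /= fvars_rename => -[[x|v] _ //= [<-]]; exact: set_valP.
Qed.

Definition eqtp (W : Type) (D : set U) (E : set W) (e e' : W -> U) : Prop :=
  forall phi : formula L (W + U), params phi `<=` D ->
    (forall w, fvars phi (inl w) -> E w) ->
    (sat (copair e id) phi <-> sat (copair e' id) phi).

Lemma eqtp_sym (W : Type) (D : set U) (E : set W) e e' :
  eqtp D E e e' -> eqtp D E e' e.
Proof. by move=> H phi pD pE; apply: iff_sym; exact: H. Qed.

Lemma eqtp_sub (W : Type) (D D' : set U) (E E' : set W) e e' :
  D `<=` D' -> E `<=` E' -> eqtp D' E' e e' -> eqtp D E e e'.
Proof.
by move=> DD EE H phi pD pE; apply: H => [|w /pE]; [exact: subset_trans DD|exact: EE].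
Qed.

Lemma eqtp_eq (W : Type) (D : set U) (E : set W) e e' :
  (forall w, E w -> e w = e' w) -> eqtp D E e e'.
Proof.
move=> H phi pD pE; suff -> : sat (copair e id) phi = sat (copair e' id) phi by [].
by apply: sat_ext_on => -[w|u] //= /pE; exact: H.
Qed.

Lemma eqtp_realizes (X : Type) (p : set (formula L (X + U))) (D : set U) a a' :
  complete_type p -> realizes_over p D a -> realizes_over p D a' ->
  eqtp D setT a a'.
Proof.
move=> pc pa pa' phi pD _.
by rewrite -(realizes_overE pc pa pD) -(realizes_overE pc pa' pD).
Qed.

Definition pinst (X W : Type) (p : set (formula L (X + U)))
    (phi : formula L (X + W)) (e : W -> U) : Prop :=
  p (frename (copair inl (inr \o e)) phi).

Lemma pinst_realizes (X W : Type) (p : set (formula L (X + U))) (D : set U)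
    (a : X -> U) (phi : formula L (X + W)) (e : W -> U) :
  complete_type p -> realizes_over p D a ->
  (forall w, fvars phi (inr w) -> D (e w)) ->
  pinst p phi e <-> sat (copair a e) phi.
Proof.
move=> pc pa pD; rewrite /pinst (realizes_overE pc pa) ?sat_rename.
  suff -> : copair a id \o copair inl (inr \o e) = copair a e by [].
  by apply/funext => -[].
by move=> u; rewrite /params /= fvars_rename => -[[x|w] //= /pD ? [<-]].
Qed.

(** Invariance for tuples of any size: a formula involves finitely many entries, and these have the
    same type over [B]. Elements of [D] may occur as well, since both sides agree over [D]. *)
Lemma pinst_eqtp (X W : Type) (p : set (formula L (X + U))) (B D : set U)
    (E : set W) (e e' : W -> U) (phi : formula L (X + (W + U))) :
  invariant_type B p -> B `<=` D -> eqtp D E e e' ->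
  (forall u, fvars phi (inr (inr u)) -> D u) ->
  (forall w, fvars phi (inr (inl w)) -> E w) ->
  pinst p phi (copair e id) -> pinst p phi (copair e' id).
Proof.
move=> pinv BD ee pD pE.
have [k [y yE]] : exists k (y : 'I_k -> W + U), range y = [set z | fvars phi (inr z)].
  apply: finite_set_ord; rewrite -(eq_finite_set (@inj_card_eq _ _ _ (@inr X _) _)).
    by apply: sub_finite_set (fvars_finite phi) => _ [z pz <-].
  by move=> u v _ _ [].
have [|phi0 phiE _] := @frename_lift L _ phi (X + 'I_k) (copair inl (inr \o y)) setT.
  move=> [x _|z pz]; first by exists (inl x).
  have [i _ <-] : range y z by rewrite yE.
  by exists (inr i).
have instE f : pinst p phi (copair f id) = p (inst (copair f id \o y) phi0).
  rewrite /pinst /inst -phiE frename_comp; congr (p (frename _ _)).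
  by apply/funext => -[].
rewrite !instE => /pinv; apply => chi.
have cE f : copair (copair f id \o y) (fun u : B => val u) =
    copair f id \o copair y (fun u : B => inr (val u)) by apply/funext => -[].
rewrite !cE -!sat_rename; apply: ee.
  move=> u; rewrite /params /= fvars_rename => -[[i _ /= yi|v _ [<-]]].
    by apply: pD; suff: [set z | fvars phi (inr z)] (inr u) by []; rewrite -yE -yi; exists i.
  by apply: BD; exact: set_valP.
move=> w; rewrite fvars_rename => -[[i _ /= yi|//]].
by apply: pE; suff: [set z | fvars phi (inr z)] (inl w) by []; rewrite -yE -yi; exists i.
Qed.

(** Entries of [e] become variables, so that one formula can be tested at two different tuples. *)
Lemma realizes_overP (X W : Type) (p : set (formula L (X + U))) (D : set U)
    (E : set W) (e : W -> U) (a : X -> U) :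
  complete_type p ->
  realizes_over p (D `|` e @` E) a <->
  (forall phi : formula L (X + (W + U)),
     (forall u, fvars phi (inr (inr u)) -> D u) ->
     (forall w, fvars phi (inr (inl w)) -> E w) ->
     pinst p phi (copair e id) -> sat (copair a (copair e id)) phi).
Proof.
move=> pc; split=> [pa phi pD pE|H phi pD].
  rewrite (pinst_realizes pc pa)// => -[w|u] pw; [right|left; exact: pD].
  by exists w => //; exact: pE.
pose P (z : X + (W + U)) := match z with
  | inl _ => True | inr (inl w) => E w | inr (inr u) => D u end.
have [|psi psiE psiP] := @frename_lift L _ phi (X + (W + U)) (copair inl (inr \o copair e id)) P.
  move=> [x _|u /pD[Du|[w Ew <-]]]; first by exists (inl x).
    by exists (inr (inr u)).
  by exists (inr (inl w)).
rewrite -{1}psiE => /H pp; rewrite -psiE sat_rename.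
suff <- : copair a (copair e id) = copair a id \o copair inl (inr \o copair e id).
  by apply: pp => [u /psiP|w /psiP].
by apply/funext => -[].
Qed.

Section Realizations.
Variables (X W : Type) (p : set (formula L (X + U))) (B D : set U).
Hypotheses (pc : complete_type p) (pinv : invariant_type B p) (BD : B `<=` D).

(** The inductive step in the uniqueness of Morley sequences: the truth of a formula at the new
    entries means that an instance over the old ones lies in [p], which by invariance depends only
    on the type of the old ones. *)
Lemma eqtp_extend (E : set W) (e e' : W -> U) (h : X -> W) :
  eqtp D E e e' ->
  realizes_over p (D `|` e @` E) (e \o h) ->
  realizes_over p (D `|` e' @` E) (e' \o h) ->
  eqtp D (E `|` range h) e e'.
Proof.
have imp f f' : eqtp D E f f' ->
    realizes_over p (D `|` f @` E) (f \o h) ->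
    realizes_over p (D `|` f' @` E) (f' \o h) ->
    forall phi : formula L (W + U), params phi `<=` D ->
      (forall w, fvars phi (inl w) -> (E `|` range h) w) ->
      sat (copair f id) phi -> sat (copair f' id) phi.
  move=> ff Hf Hf' phi pD pE.
  pose P (z : X + (W + U)) := match z with
    | inl _ => True | inr (inl w) => E w | inr (inr u) => D u end.
  have [|psi psiE psiP] := @frename_lift L _ phi (X + (W + U)) (copair (inl \o h) id) P.
    move=> [w /pE[Ew|[x _ <-]]|u /pD Du]; [by exists (inr (inl w))|by exists (inl x)|].
    by exists (inr (inr u)).
  have cE g : copair g id \o copair (inl \o h) id = copair (g \o h) (copair g id).
    by apply/funext => -[].
  have psiD u : fvars psi (inr (inr u)) -> D u by move/psiP.
  have psiEE w : fvars psi (inr (inl w)) -> E w by move/psiP.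
  have fD g w : fvars psi (inr w) -> (D `|` g @` E) (copair g id w).
    by case: w => [w /psiEE Ew|u /psiD]; [right; exists w|left].
  rewrite -psiE !sat_rename !cE.
  rewrite -(pinst_realizes pc Hf)// => [|w]; last exact: fD.
  rewrite -(pinst_realizes pc Hf')// => [|w]; last exact: fD.
  exact: pinst_eqtp pinv BD ff psiD psiEE.
move=> ee He He' phi pD pE; split; first exact: imp.
by apply: imp => //; exact: eqtp_sym.
Qed.

(** Independence is a property of the type over [D]; this carries it from a constructed tuple to a
    given one. *)
Lemma realizes_transfer (E : set W) (e e' : W -> U) (h : X -> W) :
  eqtp D (E `|` range h) e e' ->
  realizes_over p (D `|` e @` E) (e \o h) ->
  realizes_over p (D `|` e' @` E) (e' \o h).
Proof.
move=> ee /(realizes_overP _ _ _ _ pc) He; apply/(realizes_overP _ _ _ _ pc).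
move=> phi pD pE pp.
have cE g : copair (g \o h) (copair g id) = copair g id \o copair (inl \o h) id.
  by apply/funext => -[].
rewrite cE -sat_rename; apply/(ee _ _ _).
- move=> u; rewrite /params /= fvars_rename => -[[//|[//|v]] /pD Dv [<-]//].
- move=> w; rewrite fvars_rename => -[[x _ [<-]|[v /pE Ev [<-]|//]]].
    by right; exists x.
  by left.
- rewrite sat_rename -cE; apply: He => //.
  apply: pinst_eqtp pinv BD _ pD pE pp.
  by apply: eqtp_sym; apply: eqtp_sub ee => //; left.
Qed.

End Realizations.

(** The pair ([a], [b]) realizes the product of [p] and [q]. If [a] failed a formula of [p] over
    [b], its negation would lie in this product, hence in the reversed one; plugging in [b] first
    puts the negation in [p], a contradiction. *)
Lemma commuting_realizes (X Y : Type) (p : set (formula L (X + U)))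
    (q : set (formula L (Y + U))) (B D : set U) (a : X -> U) (b : Y -> U) :
  complete_type p -> complete_type q -> invariant_type B q ->
  commuting_types B p q -> B `<=` D ->
  realizes_over p D a -> realizes_over q (D `|` range a) b ->
  realizes_over p (D `|` range b) a.
Proof.
move=> pc qc qinv pq BD pa qb.
apply/(realizes_overP _ _ _ _ pc) => phi pD _ pp; apply: contrapT => nphi.
pose reassoc : X + (Y + U) -> (X + Y) + U :=
  copair (inl \o inl) (copair (inl \o inr) inr).
pose theta := frename reassoc (Neg phi).
have fvarsN (Z : Type) (f : X + (Y + U) -> Z) :
    fvars (frename f (Neg phi)) = f @` fvars phi.
  by rewrite (fvars_rename (Neg phi)) /= setU0.
have thetaD : params theta `<=` D.
  move=> u; rewrite /params /mkset /theta fvarsN => -[[x|[y|v]] pv //= [<-]].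
  exact: pD.
have plugE a0 : plug a0 theta =
    frename (copair inl (inr \o copair a0 id)) (frename
      (copair (inr \o inl) (copair inl (inr \o inr))) (Neg phi)).
  rewrite /plug !frename_comp; congr frename; by apply/funext => -[|[]].
have : otimes B p q theta.
  move=> a' /realizes_restr pa'.
  set psi := frename (copair (inr \o inl) (copair inl (inr \o inr))) (Neg phi) in plugE.
  have psiB u : fvars psi (inr (inr u)) -> (B `|` params theta) u.
    rewrite /psi fvarsN => -[[//|[//|v]] pv [<-]]; right.
    by rewrite /params /mkset /theta fvarsN; exists (inr (inr v)).
  have Bsub : B `|` params theta `<=` D by rewrite subUset.
  have paB := realizes_over_sub Bsub pa.
  rewrite plugE; apply: (pinst_eqtp qinv (@subsetUl _ _ _) (eqtp_realizes pc paB pa')) => //.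
  apply: (pinst_realizes qc qb _).2.
    by move=> [x _|u /psiB/Bsub]; [right; exists x|left].
  rewrite sat_rename (_ : _ \o _ = copair a (copair b id))//.
  by apply/funext => -[|[]].
move=> /pq; set theta' := frename _ theta => /(_ b).
have theta'D : params theta' `<=` D.
  move=> u; rewrite /params /mkset /theta' (fvars_rename theta).
  by move=> [[[x|y]|v] tv //= [<-]]; exact: thetaD.
have H : realizes (restr (C := B `|` params theta') q) b.
  apply/realizes_restr; apply: realizes_over_sub qb.
  by rewrite subUset; split=> u ?; left; [exact: BD|exact: theta'D].
move=> /(_ H).
have -> : plug b theta' = Neg (frename (copair inl (inr \o copair b id)) phi).
  rewrite /plug /theta' /theta !frename_comp /=; congr Neg; congr frename.
  by apply/funext => -[|[]].
by move/(complete_type_neg _ pc); apply.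
Qed.

End TypesOverU.

(** * Products of types *)

Lemma params_finite (L : language) (U : structure L) (X : Type)
    (phi : formula L (X + U)) : finite_set (params phi).
Proof.
rewrite -(eq_finite_set (@inj_card_eq _ _ _ (@inr X U) _)).
  by apply: sub_finite_set (fvars_finite phi) => _ [u pu <-].
by move=> u v _ _ [].
Qed.

Section RenameVariables.
Variables (L : language) (U : structure L) (V W : Type).
Variables (s : V -> W) (g : W -> V) (sK : cancel s g) (gK : cancel g s).
Variable P : set (formula L (V + U)).

Let ren (A B : Type) (f : A -> B) : A + U -> B + U := copair (inl \o f) inr.

Let renK : ren s \o ren g = id.
Proof. by apply/funext => -[w|] //=; rewrite gK. Qed.

Let renK' : ren g \o ren s = id.
Proof. by apply/funext => -[w|] //=; rewrite sK. Qed.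

(** [otimes_seq] is an image under a bijective renaming; as a preimage under the inverse, it
    inherits the properties of [P] directly. *)
Lemma frename_image : frename (ren s) @` P = [set phi | P (frename (ren g) phi)].
Proof.
apply/seteqP; split=> [_ [phi Pphi <-]|phi /= Pphi].
  by rewrite /= frename_comp renK' frename_id.
by exists (frename (ren g) phi) => //; rewrite frename_comp renK frename_id.
Qed.

Lemma complete_type_rename : complete_type P ->
  complete_type (frename (ren s) @` P).
Proof.
move=> [Pfin Pc]; rewrite frename_image; split=> [F Ffin FP|phi].
  have [||a Ha] := Pfin (frename (ren g) @` F).
  - exact: finite_image.
  - by move=> _ [phi /FP ? <-].
  exists (a \o g) => phi Fphi; have := Ha (frename (ren g) phi).
  rewrite sat_rename (_ : _ \o _ = copair (a \o g) id).
    by apply; exists phi.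
  by apply/funext => -[].
exact: (Pc (frename (ren g) phi)).
Qed.

Lemma invariant_type_rename (B : set U) : invariant_type B P ->
  invariant_type B (frename (ren s) @` P).
Proof.
move=> Pinv; rewrite frename_image => k phi d d' /=.
have instE e : frename (ren g) (inst e phi) =
    inst e (frename (copair (inl \o g) inr) phi).
  by rewrite /inst !frename_comp; congr frename; apply/funext => -[].
by rewrite !instE; exact: Pinv.
Qed.

Lemma realizes_over_rename (D : set U) (a : W -> U) :
  realizes_over P D (a \o s) -> realizes_over (frename (ren s) @` P) D a.
Proof.
move=> H; rewrite frename_image => phi pD /= /H.
rewrite sat_rename (_ : _ \o _ = copair a id); last first.
  by apply/funext => -[w|] //=; rewrite gK.
apply=> u; rewrite /params /= fvars_rename => -[[//|v] pv [<-]].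
exact: pD.
Qed.

End RenameVariables.

Section Products.
Variables (L : language) (T : theory L) (K : Type) (U : structure L).
Hypothesis U_monster : monster T K U.
Variables (B : set U) (B_small : small K B).

Let K_nat : small K [set: nat] := monster_large_nat U_monster.

Lemma realizes_over_exists (X : Type) (p : set (formula L (X + U))) (D : set U) :
  complete_type p -> small K [set: X] -> small K D ->
  exists a, realizes_over p D a.
Proof.
move=> [pfin _] KX KD.
have [|F Ffin Fp|a Ha] := @saturation L U T K U_monster X D
  [set phi | p phi /\ params phi `<=` D] KX KD.
- by move=> phi [].
- by apply: pfin => // phi /Fp[].
- by exists a => phi pD pp; exact: Ha.
Qed.

Section Binary.
Variables (X Y : Type) (p : set (formula L (X + U))) (q : set (formula L (Y + U))).
Hypotheses (X_small : small K [set: X]) (pc : complete_type p).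
Hypotheses (qc : complete_type q) (qinv : invariant_type B q).

Let plugW (phi : formula L ((X + Y) + U)) : formula L (Y + (X + U)) :=
  frename (copair (copair (inr \o inl) inl) (inr \o inr)) phi.

Let plugE a phi : plug a phi =
  frename (copair inl (inr \o copair a id)) (plugW phi).
Proof. by rewrite /plug frename_comp; congr frename; apply/funext => -[[]|]. Qed.

Let plugW_params phi u : fvars (plugW phi) (inr (inr u)) -> params phi u.
Proof. by rewrite fvars_rename => -[[[x|y]|v] //= pv [<-]]. Qed.

(** One realization decides membership: any two have the same type over [B] and the parameters, and
    [q] is invariant. *)
Lemma otimesE (D : set U) a phi : B `<=` D -> params phi `<=` D ->
  realizes_over p D a -> otimes B p q phi <-> q (plug a phi).
Proof.
move=> BD pD pa; have BpD : B `|` params phi `<=` D by rewrite subUset.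
split=> [|qa a' /realizes_restr pa'].
  by apply; apply/realizes_restr; exact: realizes_over_sub pa.
have := eqtp_realizes pc (realizes_over_sub BpD pa) pa'.
move: qa; rewrite !plugE => qa aa'.
apply: (pinst_eqtp qinv (@subsetUl _ _ _) aa') qa => // u /plugW_params; by right.
Qed.

(** Saturation supplies a realization of [p] over the relevant parameters; [otimesE] then reduces
    both claims to [q]. *)
Lemma otimes_complete : complete_type (otimes B p q).
Proof.
split=> [F Ffin Fpq|phi].
  pose D := B `|` \bigcup_(phi in F) params phi.
  have KD : small K D.
    apply: small_setU => //; apply: small_finite => //.
    by apply: bigcup_finite => // phi _; exact: params_finite.
  have [a pa] := realizes_over_exists pc X_small KD.
  have [||b qb] := qc.1 (plug a @` F).
  - exact: finite_image.
  - move=> _ [phi Fphi <-]; apply: (otimesE _ _ pa).1 (Fpq _ Fphi).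
      exact: subsetUl.
    by move=> u pu; right; exists phi.
  exists (copair a b) => phi Fphi; have := qb (plug a phi).
  rewrite sat_rename (_ : _ \o _ = copair (copair a b) id).
    by apply; exists phi.
  by apply/funext => -[[]|].
have [a pa] : exists a, realizes_over p (B `|` params phi) a.
  apply: realizes_over_exists => //; apply: small_setU => //.
  exact/small_finite/params_finite.
have pphi := @subsetUr _ B (params phi).
have pN : params (Neg phi) `<=` B `|` params phi.
  by move=> u [?|//]; right.
rewrite !(propext (otimesE _ _ pa))//; try exact: subsetUl.
exact: (qc.2 (plug a phi)).
Qed.

Lemma otimes_realizes (D : set U) a b : B `<=` D -> realizes_over p D a ->
  realizes_over q (D `|` range a) b -> realizes_over (otimes B p q) D (copair a b).
Proof.
move=> BD pa qb phi pD /(otimesE BD pD pa).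
rewrite plugE -/(pinst q (plugW phi) (copair a id)) (pinst_realizes qc qb).
  rewrite sat_rename (_ : _ \o _ = copair (copair a b) id)//.
  by apply/funext => -[[]|].
by move=> [x _|u /plugW_params/pD]; [right; exists x|left].
Qed.

Lemma otimes_invariant : invariant_type B p -> invariant_type B (otimes B p q).
Proof.
move=> pinv k phi d d' pq dd' a' /realizes_restr pa'.
have [a pa] : exists a, realizes_over p (B `|` params (inst d phi)) a.
  apply: realizes_over_exists => //; apply: small_setU => //.
  exact/small_finite/params_finite.
have {}pq : q (plug a (inst d phi)) by apply: pq; exact/realizes_restr.
pose psi : formula L (Y + ((X + 'I_k) + U)) :=
  frename (copair (copair (inr \o inl \o inl) inl) (inr \o inl \o inr)) phi.
have psiE a0 d0 : plug a0 (inst d0 phi) =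
    frename (copair inl (inr \o copair (copair a0 d0) id)) psi.
  rewrite /plug /inst !frename_comp; congr frename.
  by apply/funext => -[[]|].
pose E : set (X + 'I_k) := [set z | if z is inr i then fvars phi (inr i) else False].
have paramsE d0 a0 : params (inst d0 phi) = copair a0 d0 @` E.
  apply/seteqP; split=> u.
    by rewrite /params /= fvars_rename => -[[//|i] pi [<-]]; exists (inr i).
  by move=> [[//|i] /= pi <-]; rewrite /params /= fvars_rename; exists (inr i).
have ee : eqtp B (E `|` range inl) (copair a d) (copair a' d').
  apply: (eqtp_extend (p := p) (B := B) pc pinv) => //.
  - move=> chi cB cE; have := dd'.
    have [|chi0 chiE _] := @frename_lift L _ chi ('I_k + B)
      (copair (inl \o inr) (fun u : B => inr (val u))) setT.
      move=> [[x /cE//|i _]|u /cB Bu]; first by exists (inl i).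
      by exists (inr (SigSub (mem_set Bu))).
    move=> /(_ chi0); rewrite -chiE !sat_rename.
    have cE' a0 d0 : copair (copair a0 d0) id \o copair (inl \o inr) (fun u : B => inr (val u)) =
        copair d0 (fun u : B => val u) by apply/funext => -[].
    by rewrite !cE'.
  - by rewrite -paramsE.
  - by rewrite -paramsE.
rewrite psiE; rewrite psiE in pq.
apply: pinst_eqtp qinv _ ee _ _ pq => //.
  by move=> u; rewrite fvars_rename => -[[[x|y]|i]].
move=> [x _|i]; first by right; exists x.
by rewrite fvars_rename => -[[[x|y]|j] //= pj [<-]]; left.
Qed.

End Binary.

Definition snoc_map (n : nat) (X : 'I_n.+1 -> Type) :
    tuple_vars (fun i => X (lift ord_max i)) + X ord_max -> tuple_vars X :=
  copair (fun z => existT X (lift ord_max (projT1 z)) (projT2 z))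
         (fun x => existT X ord_max x).

Lemma snoc_map_bij (n : nat) (X : 'I_n.+1 -> Type) :
  exists g, cancel (@snoc_map n X) g /\ cancel g (@snoc_map n X).
Proof.
set s := @snoc_map n X.
have surj z : exists y, s y = z.
  case: z => i x; case: (unliftP ord_max i) x => [j|] -> x; last by exists (inr x).
  by exists (inl (existT _ j x)).
have inj : injective s.
  move=> [[i x]|x] [[j y]|y] /= e.
  - have /lift_inj ij := congr1 (@projT1 _ _) e; move: y e => /=; rewrite -{}ij => y.
    by move=> /(@eq_from_Tagged 'I_n.+1 X (lift ord_max i) x y) ->.
  - by have /eqP := congr1 (@projT1 _ _) e; rewrite eq_sym (negbTE (neq_lift _ _)).
  - by have /eqP := congr1 (@projT1 _ _) e; rewrite (negbTE (neq_lift _ _)).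
  - by move: e => /(@eq_from_Tagged 'I_n.+1 X ord_max x y) ->.
have [g gs] := choice surj.
by exists g; split=> // y; apply: inj; rewrite gs.
Qed.

(** The three properties go through one induction, since each step needs the product so far to be
    complete and invariant. The last one says that successive realizations realize the product. *)
Lemma otimes_seqP (n : nat) (X : 'I_n -> Type)
    (p : forall i, set (formula L (X i + U))) :
  (forall i, small K [set: X i]) -> (forall i, complete_type (p i)) ->
  (forall i, invariant_type B (p i)) ->
  [/\ complete_type (otimes_seq B p), invariant_type B (otimes_seq B p) &
   forall (D : set U) (a : tuple_vars X -> U), B `<=` D ->
     (forall k, realizes_over (p k)
        (D `|` a @` [set z : tuple_vars X | (projT1 z < k)%N]) (fun x => a (existT X k x))) ->
     realizes_over (otimes_seq B p) D a].
Proof.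
elim: n X p => [|n IH] X p KX pc pinv.
  have uniq (a a' : tuple_vars X -> U) : a = a' by apply/funext => -[[]].
  have [a0] : inhabited (tuple_vars X -> U) by apply: inhabits => -[[]].
  split=> [|k phi d d' /= [a sa] dd'|D a BD _ phi _ /= [a' sa]].
  - split=> [F _ FP|phi /=].
      by exists a0 => phi /FP /= [a]; rewrite (uniq a a0).
    by have [?|?] := pselect (sat (copair a0 id) phi); [left|right]; exists a0.
  - exists a; have [[[[]]//|i _]|phi0 phiE _] := @frename_lift L _ phi 'I_k inr setT.
      by exists i.
    have := dd' (frename inl phi0); move: sa; rewrite -phiE /inst !sat_rename.
    by move=> sa [+ _]; apply.
  - by rewrite (uniq a a').
have [||| Pc Pinv Preal] := IH _ (fun i => p (lift ord_max i)) => //.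
set P := otimes_seq B _ in Pc Pinv Preal.
have [g [sK gK]] := snoc_map_bij X.
have KX' : small K [set: tuple_vars (fun i => X (lift ord_max i))].
  exact: small_tuple.
have Pp : complete_type (otimes B P (p ord_max)) by exact: otimes_complete.
have Pi : invariant_type B (otimes B P (p ord_max)) by exact: otimes_invariant.
split.
- exact: complete_type_rename sK gK _ Pp.
- exact: invariant_type_rename sK gK _ _ Pi.
move=> D a BD pa; apply: (realizes_over_rename sK gK).
rewrite (_ : a \o _ = copair (a \o @snoc_map n X \o inl) (a \o @snoc_map n X \o inr)); last first.
  by apply/funext => -[].
apply: otimes_realizes => //.
  apply: Preal => // k; apply: realizes_over_sub (pa (lift ord_max k)) => u.
  move=> [Du|[[j x] /= jk <-]]; [by left|right].
  (* [lift ord_max] preserves values, so the order of the components is unchanged. *)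
  by exists (existT X (lift ord_max j) x); rewrite //= /bump [n <= j]leqNgt [n <= k]leqNgt !ltn_ord.
apply: realizes_over_sub (pa ord_max) => u [Du|[[j x] _ <-]]; [by left|right].
by exists (existT X (lift ord_max j) x); rewrite //= /bump [n <= j]leqNgt !ltn_ord.
Qed.
End Products.

(** * Generic families *)

Lemma realizes_over_finite (L : language) (U : structure L) (X W : Type)
    (p : set (formula L (X + U))) (D : set U) (E : set W) (e : W -> U) a :
  complete_type p ->
  (forall E', finite_set E' -> E' `<=` E -> realizes_over p (D `|` e @` E') a) ->
  realizes_over p (D `|` e @` E) a.
Proof.
move=> pc H; apply/(realizes_overP _ _ _ _ pc) => phi pD pE.
have fin : finite_set [set w | fvars phi (inr (inl w))].
  rewrite -(eq_finite_set (@inj_card_eq _ _ _ (fun w : W => inr (inl w) : X + (W + U)) _)).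
    by apply: sub_finite_set (fvars_finite phi) => _ [u pu <-].
  by move=> u v _ _ [].
by have /(realizes_overP _ _ _ _ pc) := H _ fin pE; apply.
Qed.

Local Notation component w j := (fun x => w (existT _ j x)).

Section Families.
Variables (L : language) (T : theory L) (K : Type) (U : structure L).
Hypothesis U_monster : monster T K U.
Variables (B : set U) (B_small : small K B).
Variables (n : nat) (X : 'I_n -> Type).
Hypothesis X_small : forall i, small K [set: X i].
Variables (p : forall i : 'I_n, set (formula L (X i + U))).
Arguments p : clear implicits.
Hypothesis p_type : forall i, complete_type (p i).
Hypothesis p_inv : forall i, invariant_type B (p i).
Arguments p_type : clear implicits.
Arguments p_inv : clear implicits.

Let K_nat : small K [set: nat] := monster_large_nat U_monster.

Variables (d : Order.disp_t) (J : orderType d) (kappa : J -> 'I_n).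

Definition fam_vars : Type := {j : J & X (kappa j)}.

(** For constant [kappa] this is a Morley sequence over [C]. The set [F] allows part of the index
    set to be discarded. *)
Definition generic (C : set U) (F : set J) (w : fam_vars -> U) : Prop :=
  forall j, F j -> realizes_over (p (kappa j))
    (C `|` w @` [set z : fam_vars | F (projT1 z) /\ (projT1 z < j)%O])
    (component w j).
Arguments generic : clear implicits.

Lemma generic_sub (C C' : set U) (F F' : set J) w :
  C `<=` C' -> F `<=` F' -> generic C' F' w -> generic C F w.
Proof.
move=> CC FF H j Fj; apply: realizes_over_sub (H j (FF _ Fj)) => u.
by move=> [/CC|[z [/FF Fz zj] <-]]; [left|right; exists z].
Qed.

Lemma finite_sorted (F : set J) : finite_set F ->
  exists2 s : seq J, sorted <%O s & F = [set` s].
Proof.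
move=> /finite_seqP[s ->]; exists (sort <=%O (undup s)).
  by rewrite sort_lt_sorted undup_uniq.
by apply/seteqP; split=> x /=; rewrite mem_sort mem_undup.
Qed.


(** A formula mentions finitely many indices; adding them in increasing order, [eqtp_extend] applies
    at each one. *)
Lemma eqtp_generic (C : set U) (F : set J) (w w' : fam_vars -> U) :
  B `<=` C -> generic C F w -> generic C F w' ->
  eqtp C [set z : fam_vars | F (projT1 z)] w w'.
Proof.
move=> BC wF w'F.
have key (s : seq J) : sorted <%O s -> [set` s] `<=` F ->
    eqtp C [set z : fam_vars | projT1 z \in s] w w'.
  elim/last_ind: s => [_ _|s x IH]; first exact: eqtp_eq.
  rewrite (sorted_pairwise (@lt_trans _ _)) pairwise_rcons.
  rewrite -(sorted_pairwise (@lt_trans _ _)) => /andP[/allP sx ss] sF.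
  have Fx : F x by apply: sF; rewrite /= mem_rcons mem_head.
  have {}sF : [set` s] `<=` F.
    by move=> y ys; apply: sF; rewrite /= mem_rcons inE (ys : y \in s) orbT.
  pose h (y : X (kappa x)) : fam_vars := existT _ x y.
  have H := eqtp_extend (h := h) (p_type (kappa x)) (p_inv (kappa x)) BC (IH ss sF).
  apply: eqtp_sub (H _ _).
  - by [].
  - move=> [j y]; rewrite /mkset /= mem_rcons inE => /orP[/eqP jx|js]; last by left.
    by right; subst j; exists y.
  - apply: realizes_over_sub (wF x Fx) => u [?|[z /= zs <-]]; [by left|right].
    by exists z => //; split; [exact: sF|exact: sx].
  - apply: realizes_over_sub (w'F x Fx) => u [?|[z /= zs <-]]; [by left|right].
    by exists z => //; split; [exact: sF|exact: sx].
move=> phi pC pF.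
have [|s ss sE] := @finite_sorted (@projT1 _ _ @` [set z : fam_vars | fvars phi (inl z)]).
  apply: finite_image; rewrite -(eq_finite_set (@inj_card_eq _ _ _ (@inl fam_vars U) _)).
    by apply: sub_finite_set (fvars_finite phi) => _ [u pu <-].
  by move=> u v _ _ [].
apply: (key s ss) => // [j|z pz].
  by rewrite -sE => -[z /pF ? <-].
by rewrite /mkset -/([set` s] (projT1 z)) -sE; exists z.
Qed.

Hypothesis J_small : small K [set: J].

Lemma small_fam_vars : small K [set: fam_vars].
Proof.
apply: (@small_inj K _ (J * tuple_vars X)%type
  (fun z => (projT1 z, existT X (kappa (projT1 z)) (projT2 z)))).
  move=> [j x] [j' x'] e; have := congr1 snd e; have /= jj := congr1 fst e.
  by subst j' => /(@eq_from_Tagged 'I_n X _ x x')->.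
by apply: small_prod => //; exact: small_tuple.
Qed.

Lemma small_setU_image (C : set U) (W : Type) (E : set W) (e : W -> U) :
  small K C -> small K [set: W] -> small K (C `|` e @` E).
Proof.
move=> KC KW; apply: small_setU => //.
by apply: small_le KW; apply: card_le_trans (card_image_le e E) _; exact: subset_card_le.
Qed.

Lemma generic_exists_seq (C : set U) (s : seq J) : small K C -> sorted <%O s ->
  exists w, generic C [set` s] w.
Proof.
move=> KC; elim/last_ind: s => [_|s x IH].
  by have [u] := domain_inh U; exists (fun=> u) => j.
rewrite (sorted_pairwise (@lt_trans _ _)) pairwise_rcons.
rewrite -(sorted_pairwise (@lt_trans _ _)) => /andP[/allP sx ss].
have [w wP] := IH ss.
have [a pa] := realizes_over_exists U_monster (p_type (kappa x)) (X_small _)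
  (small_setU_image [set z : fam_vars | projT1 z \in s] w KC small_fam_vars).
pose f : forall j, X (kappa j) -> U := dfwith (fun j => component w j) a.
have fx : f x = a by rewrite /f dfwith_in.
have fs j : j \in s -> f j = component w j.
  by move=> /sx jx; rewrite /f dfwith_out// (gt_eqF jx).
have im j : (j <= x)%O -> (fun z : fam_vars => f (projT1 z) (projT2 z)) @`
    [set z | projT1 z \in rcons s x /\ (projT1 z < j)%O] `<=`
    w @` [set z : fam_vars | projT1 z \in s /\ (projT1 z < j)%O].
  move=> jx _ [[i y] /= [+ ij] <-]; rewrite mem_rcons inE => /orP[/eqP ix|i_s].
    by exfalso; have := lt_le_trans ij jx; rewrite ix ltxx.
  by exists (existT _ i y) => //=; rewrite fs.
exists (fun z => f (projT1 z) (projT2 z)) => j; rewrite /mkset mem_rcons inE.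
move=> /orP[/eqP ->|js].
  rewrite -fx in pa; apply: realizes_over_sub pa => u [Cu|]; first by left.
  by move=> /(im _ (lexx _))[z [? _] <-]; right; exists z.
have := wP j js; rewrite -fs//; apply: realizes_over_sub => u [Cu|]; first by left.
by move=> /(im _ (ltW (sx _ js))); right.
Qed.

(** The order on [J] need not be a well-order, so recursion is replaced by compactness. The formulas
    realized are those true in every family generic along some finite list; finitely many lists
    merge into one, and [generic_exists_seq] handles it. *)
Lemma generic_exists (C : set U) : B `<=` C -> small K C ->
  exists w, generic C setT w.
Proof.
move=> BC KC.
pose forced phi := exists s : seq J,
  forall w, generic C [set` s] w -> sat (copair w id) phi.
have [|F Ffin FS|w wP] := @saturation L U T K U_monster fam_vars C
  [set phi | params phi `<=` C /\ forced phi] small_fam_vars KC.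
- by move=> phi [].
- have /choice[s sP] : forall phi, exists s : seq J, F phi ->
      forall w, generic C [set` s] w -> sat (copair w id) phi.
    move=> phi; have [/FS[_ [s sP]]|?] := pselect (F phi); last by exists [::].
    by exists s.
  have [|t tt tE] := @finite_sorted (\bigcup_(phi in F) [set` s phi]).
    by apply: bigcup_finite => // phi _; exact: finite_seq.
  have [w wt] := generic_exists_seq KC tt.
  exists w => phi Fphi; apply: sP => //; apply: generic_sub wt => //.
  by rewrite -tE => j js; exists phi.
(* On each finite list [w] has the type of a generic family, so genericity transfers to it. *)
exists w => j _; apply: realizes_over_finite => // E Efin EJ.
have [|s ss sE] := @finite_sorted ([set j] `|` @projT1 _ _ @` E).
  by rewrite finite_setU; split; [exact: finite_set1|exact: finite_image].
have [w' w'P] := generic_exists_seq KC ss.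
have w'w : eqtp C [set z : fam_vars | projT1 z \in s] w' w.
  have imp phi : params phi `<=` C -> (forall z : fam_vars, fvars phi (inl z) -> projT1 z \in s) ->
      sat (copair w' id) phi -> sat (copair w id) phi.
    move=> pC ps sw'; apply: wP; split=> //; exists s => v vs.
    by apply/(eqtp_generic BC vs w'P) => // z /ps.
  move=> phi pC ps; split; first exact: imp.
  move=> sw; apply: contrapT => nsw'; apply: (imp (Neg phi)) sw => //.
    by move=> u [|//]; exact: pC.
  by move=> z [|//]; exact: ps.
have js : j \in s by suff: [set` s] j by []; rewrite -sE; left.
have Es : E `<=` [set z | projT1 z \in s].
  by move=> z Ez; suff: [set` s] (projT1 z) by []; rewrite -sE; right; exists z.
pose h (x : X (kappa j)) : fam_vars := existT _ j x.
have := @realizes_transfer L U (X (kappa j)) fam_vars (p (kappa j)) B C (p_type _) (p_inv _) BC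
  E w' w h; apply.
  by apply: eqtp_sub w'w => // z [/Es//|[x _ <-]].
apply: realizes_over_sub (w'P j js) => u [?|[z Ez <-]]; [by left|right].
by exists z => //; split; [exact: Es|have [] := EJ _ Ez].
Qed.

Hypothesis p_comm : forall i j : 'I_n, i != j -> commuting_types B (p i) (p j).
Arguments p_comm : clear implicits.

(* Commutation makes the relative order of components of different types
   irrelevant. *)
Lemma generic_strong (C : set U) (F : set J) w j : B `<=` C ->
  generic C F w -> F j -> realizes_over (p (kappa j))
    (C `|` w @` [set z : fam_vars | F (projT1 z) /\
      ((projT1 z < j)%O \/ kappa (projT1 z) != kappa j)]) (component w j).
Proof.
move=> BC wF Fj.
pose D := C `|` w @` [set z : fam_vars | F (projT1 z) /\ (projT1 z < j)%O].
(* Later indices of other types are absorbed one at a time: the entry at the last index realizes its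
   type over all that precedes it, entry [j] included, and [commuting_realizes] reverses the
   dependence. *)
have key (s : seq J) : sorted <%O s ->
    (forall i, i \in s -> [/\ F i, (j < i)%O & kappa i != kappa j]) ->
    realizes_over (p (kappa j)) (D `|` w @` [set z : fam_vars | projT1 z \in s])
      (component w j).
  elim/last_ind: s => [_ _|s x IH].
    by apply: realizes_over_sub (wF j Fj) => u [//|[]].
  rewrite (sorted_pairwise (@lt_trans _ _)) pairwise_rcons.
  rewrite -(sorted_pairwise (@lt_trans _ _)) => /andP[/allP sx ss] sF.
  have [Fx jx kx] : [/\ F x, (j < x)%O & kappa x != kappa j].
    by apply: sF; rewrite mem_rcons mem_head.
  have {}sF i : i \in s -> [/\ F i, (j < i)%O & kappa i != kappa j].
    by move=> i_s; apply: sF; rewrite mem_rcons inE i_s orbT.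
  have jr := IH ss sF.
  have := commuting_realizes (p_type _) (p_type _) (p_inv (kappa x)) (p_comm _ _ _) _ jr
    (b := component w x); rewrite eq_sym => /(_ kx) H.
  apply: realizes_over_sub (H _ _).
  - move=> u [Du|[[i y] /= + <-]]; first by do 2!left.
    rewrite mem_rcons inE => /orP[/eqP ix|i_s].
      by right; subst i; exists y.
    by left; right; exists (existT _ i y).
  - by move=> u /BC; do 2!left.
  - apply: realizes_over_sub (wF x Fx) => u [[[Cu|[z [Fz zj] <-]]|[z zs <-]]|[y _ <-]].
    + by left.
    + by right; exists z => //; split=> //; exact: lt_trans zj jx.
    + by right; exists z => //; split; [have [] := sF _ zs|exact: sx].
    + by right; exists (existT _ j y).
apply: realizes_over_finite => // E Efin EF.
have [|s ss sE] := @finite_sorted ((@projT1 _ _ @` E) `&` [set i | (j < i)%O]).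
  by apply: finite_setIl; exact: finite_image.
apply: realizes_over_sub (key s ss _).
  move=> u [Cu|[z Ez <-]]; first by do 2!left.
  have [Fz zj] := EF _ Ez.
  have [zj'|jz|zj'] := ltgtP (projT1 z) j.
  - by left; right; exists z.
  - right; exists z => //; suff: [set` s] (projT1 z) by [].
    by rewrite -sE; split=> //; exists z.
  - by case: zj; rewrite zj' ?ltxx ?eqxx.
move=> i i_s; have : [set` s] i by [].
rewrite -sE => -[[z /EF[Fz zj] <-] ji]; split=> //.
by case: zj => // /(lt_trans ji); rewrite ltxx.
Qed.

End Families.

(** * Distality *)

Section Distality.
Variables (L : language) (T : theory L) (K : Type) (U : structure L).
Hypothesis U_monster : monster T K U.
Variable B : set U.
Variables (m : nat) (T_distal : distal K U m).
Variable X : 'I_m.+1 -> Type.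
Hypothesis X_small : forall i, small K [set: X i].
Variable P : forall i : 'I_m.+1, set (formula L (X i + U)).
Arguments P : clear implicits.
Hypothesis P_type : forall i, complete_type (P i).
Hypothesis P_inv : forall i, invariant_type B (P i).
Arguments P_type : clear implicits.
Arguments P_inv : clear implicits.

Let K_nat : small K [set: nat] := monster_large_nat U_monster.

(* The positions [(2k, _)] form the [k]-th piece of a Dedekind partition, and
   [(2l+1, 0)] lies in its [l]-th cut. *)
Definition pos : Type := (nat *l int)%type.

Definition cut (l : nat) : pos := (l.*2.+1, 0%R).

Variables (D : set U) (BD : B `<=` D) (D_small : small K D).
Variable z : pos -> forall j : 'I_m.+1, X j -> U.
Arguments z : clear implicits.

(** Without the entry of column [l] at its own cut, the array consists of Morley sequences, one per
    column, each entry being independent of all other columns. *)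
Hypothesis z_generic : forall (l : 'I_m.+1) (t : pos) (j : 'I_m.+1),
  (t, j) <> (cut l, l) -> realizes_over (P j)
    (D `|` [set u | exists t' j' x, [/\ (t', j') <> (cut l, l),
       j' != j \/ (t' < t)%O & u = z t' j' x]]) (z t j).

(** Every row carries all of [D] as constant coordinates, so indiscernibility of rows is
    indiscernibility over [D]. *)
Let S : Type := (D + tuple_vars X)%type.

Let row (t : pos) (s : S) : U :=
  match s with inl u => val u | inr v => z t (projT1 v) (projT2 v) end.

(** Rows avoiding the [l]-th cut, read lexicographically, form a generic family by [z_generic], and
    [eqtp_generic] makes the type of increasing rows unique. *)
Let row_indiscernible (J : Type) (lt : rel J) (tau : J -> pos) (l : 'I_m.+1) :
  (forall i j, lt i j -> (tau i < tau j)%O) -> (forall i, tau i <> cut l) ->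
  indiscernible lt (fun i => row (tau i)).
Proof.
move=> tau_lt tauN q phi.
pose kappa (ij : ('I_q *l 'I_m.+1)%type) : 'I_m.+1 := ij.2.
pose w (j : 'I_q -> J) : fam_vars X kappa -> U :=
  fun v => z (tau (j (projT1 v).1)) (projT1 v).2 (projT2 v).
have wP j : (forall k l : 'I_q, (k < l)%N -> lt (j k) (j l)) ->
    generic P D setT (w j).
  move=> j_lt [k i] _.
  have /z_generic H : (tau (j k), i) <> (cut l, l) by case=> /tauN.
  apply: (realizes_over_sub _ H).
  move=> u [Du|[[[k' i'] x] /= [_ kk] <-]]; [by left|right].
  move: kk; rewrite ltxi_pair => /andP[kk /implyP ii].
  exists (tau (j k')), i', x; split=> //; first by case=> /tauN.
    have [ei|] := eqVneq i' i; [right|by left].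
    apply/tau_lt/j_lt; rewrite ltnNge; apply/negP => /ii.
    by rewrite ei ltxx.
have same j j' : (forall k l : 'I_q, (k < l)%N -> lt (j k) (j l)) ->
    (forall k l : 'I_q, (k < l)%N -> lt (j' k) (j' l)) ->
    sat (fun ks => row (tau (j ks.1)) ks.2) phi ->
    sat (fun ks => row (tau (j' ks.1)) ks.2) phi.
  move=> /wP jP /wP j'P.
  pose g (ks : 'I_q * S) : fam_vars X kappa + U := match ks.2 with
    | inl u => inr (val u)
    | inr v => inl (existT (fun i => X (kappa i)) (ks.1, projT1 v) (projT2 v)) end.
  have gE i : (fun ks => row (tau (i ks.1)) ks.2) = copair (w i) id \o g.
    by apply/funext => -[k [u|[]]].
  rewrite !gE -!sat_rename => sj.
  apply/(eqtp_generic P_type P_inv BD j'P jP) => // u.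
    rewrite /params /= fvars_rename => -[[k [v|[]]] _ //= [<-]].
    exact: set_valP.
have [[j [j_lt sj]]|nex] := pselect (exists j : 'I_q -> J,
    (forall k l : 'I_q, (k < l)%N -> lt (j k) (j l)) /\
    sat (fun ks => row (tau (j ks.1)) ks.2) phi).
  by left => j' j'_lt; exact: same j_lt j'_lt sj.
by right => j' j'_lt sj'; apply: nex; exists j'.
Qed.

(** Each piece is a copy of the integers, which have no end points, so the partition is Dedekind. *)
Let I : Type := ('I_m.+2 *l int)%type.

Let even_pos (i : I) : pos := (i.1.*2, i.2).

Let even_pos_neq i l : even_pos i <> cut l.
Proof. by move=> [/(congr1 odd)]; rewrite /= !odd_double. Qed.

Let b (i : I) : S -> U := row (even_pos i).

Let a (l : 'I_m.+1) : S -> U := row (cut l).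

Let c (i : I) : 'I_m.+2 := i.1.

Let all_insert : inserts c b a [set: 'I_m.+1]%SET.
Proof.
have even_lt (i j : I) : (i < j)%O -> (even_pos i < even_pos j)%O.
  case: i j => [i x] [j y]; rewrite !ltxi_pair /even_pos /=.
  by rewrite !leEnat !leEord !leq_double.
have ins_pos (A : {set 'I_m.+1}) (l : 'I_m.+1) : l \notin A -> inserts c b a A.
  move=> lA; pose tau (x : ins_index I A) : pos :=
    match x with inl i => even_pos i | inr k => cut (val k) end.
  rewrite /inserts (_ : @ins_seq L U S _ _ _ b a A = fun x => row (tau x)); last first.
    by apply/funext => -[].
  apply: (@row_indiscernible _ _ _ l).
    move=> [i|k] [j|k'] /=.
    - exact: even_lt.
    - by rewrite /c ltxi_pair /= !leEnat => ?; apply/andP; split; [|apply/implyP]; lia.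
    - by rewrite /c ltxi_pair /= !leEnat => ?; apply/andP; split; [|apply/implyP]; lia.
    - by rewrite ltxi_pair /= !leEnat => ?; apply/andP; split; [|apply/implyP]; lia.
  move=> [i|[k kA]] /=; first exact: even_pos_neq.
  move=> [/double_inj kl]; move: lA; rewrite (_ : l = k) ?kA//.
  exact/val_inj.
apply: contrapT => nins.
have I_infinite : infinite_set [set: I].
  apply/infiniteP/card_leTP; exists (fun k => (ord0, Posz k)) => k k'.
  by case.
have I_small : small K [set: I].
  by apply: (@small_inj K I nat (@pickle ('I_m.+2 * int)%type)) => //; exact: pcan_inj pickleK.
have S_small : small K [set: S].
  apply: small_sum => //; last exact: small_tuple.
  exact/small_setT.
have b_indis : indiscernible (<%O : rel I) b.
  exact: (row_indiscernible (l := ord0) even_lt (fun i => @even_pos_neq i _)).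
have c_dedekind : dedekind c.
  split.
  - by move=> [i x] [j y]; rewrite lexi_pair => /andP[].
  - by move=> k; exists (k, 0%R).
  - move=> k [i x] /= ik; exists (i, x + 1)%R; split=> //.
    by rewrite ltxi_pair lexx /=; lia.
  - move=> k [i x] /= ik; exists (i, x - 1)%R; split=> //.
    by rewrite ltxi_pair lexx /=; lia.
have S_complete : complete_EM_type U K (EM_type (<%O : rel I) b).
  by exists _, I, b.
have [A [Am nA]] := T_distal S_small S_complete I_small b_indis erefl c_dedekind nins.
(* An [m]-element set misses one of the [m.+1] cuts, and then the remaining rows insert by
   [row_indiscernible]. *)
have [l lA] : exists l, l \notin A.
  apply/existsP; rewrite -negb_forall; apply/negP => /forallP AT.
  have : A = [set: _]%SET by apply/setP => l; rewrite inE AT.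
  by move: Am => /[swap] ->; rewrite cardsT card_ord => /eqP; rewrite eqn_leq ltnn.
exact: nA (ins_pos _ _ lA).
Qed.

(** Since all rows insert, the diagonal entries [aa] at the cuts have the type over [D] of the
    entries [ww] taken from rows of the original sequence, whose independence is part of
    [z_generic]. *)
Lemma distal_independent (j : 'I_m.+1) :
  realizes_over (P j)
    (D `|` [set u | exists (j' : 'I_m.+1) x, j' != j /\ u = z (cut j') j' x])
    (z (cut j) j).
Proof.
pose aa (v : tuple_vars X) : U := z (cut (projT1 v)) (projT1 v) (projT2 v).
pose ww (v : tuple_vars X) : U := z ((projT1 v).*2, 0%R) (projT1 v) (projT2 v).
have aw : eqtp D setT ww aa.
  move=> phi phiD _.
  have [[v _|u /phiD Du]|phi1 phiE _] := @frename_lift L _ phi (tuple_vars X + D)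
    (copair inl (fun u : D => inr (val u))) setT.
  - by exists (inl v).
  - by exists (inr (SigSub (mem_set Du))).
  (* Component [k] is read from the [k]-th row and parameters from row 0; any row would give the
     same parameters. *)
  pose g (v : tuple_vars X + D) : 'I_m.+1 * S := match v with
    | inl v => (projT1 v, inr v) | inr u => (ord0, inl u) end.
  pose s1 (k : 'I_m.+1) : ins_index I [set: 'I_m.+1]%SET :=
    inr (exist _ k (finset.in_setT k)).
  pose s2 (k : 'I_m.+1) : ins_index I [set: 'I_m.+1]%SET :=
    inl (widen_ord (leqnSn _) k, 0%R).
  have sat1 psi : sat (fun ks => ins_seq b a (s1 ks.1) ks.2) (frename g psi) =
      sat (copair aa (fun u : D => val u)) psi.
    by rewrite sat_rename; congr sat; apply/funext => -[].
  have sat2 psi : sat (fun ks => ins_seq b a (s2 ks.1) ks.2) (frename g psi) =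
      sat (copair ww (fun u : D => val u)) psi.
    by rewrite sat_rename; congr sat; apply/funext => -[].
  have lt1 (k l : 'I_m.+1) : (k < l)%N -> ins_lt c (s1 k) (s1 l) by [].
  have lt2 (k l : 'I_m.+1) : (k < l)%N -> ins_lt c (s2 k) (s2 l).
    by move=> kl; rewrite /= ltxi_pair; apply/andP; split; [|apply/implyP];
      rewrite leEord /=; lia.
  have satE e : sat (copair e id) phi = sat (copair e (fun u : D => val u)) phi1.
    by rewrite -phiE sat_rename; congr sat; apply/funext => -[].
  rewrite !satE -sat1 -sat2.
  have [E|E] := all_insert (frename g phi1).
    by split=> _; apply: E.
  by split=> sp; [have := E _ lt2 sp|have := E _ lt1 sp].
have notcut (i l : 'I_m.+1) : ((i.*2, 0%R) : pos, i) <> (cut l, l).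
  by move=> [/(congr1 odd)]; rewrite /= !odd_double.
pose E := [set v : tuple_vars X | projT1 v != j].
have := @realizes_transfer L U (X j) (tuple_vars X) (P j) B D (P_type j) (P_inv j) BD E
  ww aa (existT _ j).
move=> H; have {}H : realizes_over (P j) (D `|` aa @` E) (aa \o existT X j).
  apply: H; first exact: eqtp_sub aw.
  have := z_generic (notcut j ord0).
  apply: realizes_over_sub => u [?|[[i x] /= ij <-]]; [by left|right].
  by exists (i.*2, 0%R), i, x; split; [exact: (notcut i ord0)|left|].
apply: realizes_over_sub H => u [?|[i [x [ij ->]]]]; [by left|right].
by exists (existT _ i x).
Qed.

End Distality.

(** * Determinacy *)

Section Determinacy.
Variables (L : language) (T : theory L) (K : Type) (U : structure L).
Hypothesis U_monster : monster T K U.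
Variables (B : set U) (B_small : small K B).
Variables (m : nat) (T_distal : distal K U m).
Variables (n : nat) (X : 'I_n -> Type).
Hypothesis X_small : forall i, small K [set: X i].
Variables (p : forall i : 'I_n, set (formula L (X i + U))).
Arguments p : clear implicits.
Hypothesis p_type : forall i, complete_type (p i).
Hypothesis p_inv : forall i, invariant_type B (p i).
Hypothesis p_comm : forall i j : 'I_n, i != j -> commuting_types B (p i) (p j).
Arguments p_type : clear implicits.
Arguments p_inv : clear implicits.

Let K_nat : small K [set: nat] := monster_large_nat U_monster.

Let small_count (V : countType) : small K [set: V].
Proof. by apply: small_inj K_nat; exact: pcan_inj pickleK. Qed.

Variable r : set (formula L (tuple_vars X + U)).
Hypothesis r_type : complete_type r.

(** The quantifier over [C] matters: the inductive step uses the hypothesis over a base enlarged by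
    part of the array. *)
Definition independent_on (M : {set 'I_n}) : Prop :=
  forall C, B `<=` C -> small K C ->
  forall a : tuple_vars X -> U, realizes_over r C a ->
  forall k, k \in M -> realizes_over (p k)
    (C `|` a @` [set v : tuple_vars X | projT1 v \in M /\ projT1 v != k])
    (component a k).

Lemma otimes_seq_realized (C : set U) : B `<=` C -> small K C ->
  exists a : tuple_vars X -> U, realizes_over (otimes_seq B p) C a /\
    forall k, realizes_over (p k)
      (C `|` a @` [set v : tuple_vars X | projT1 v != k]) (component a k).
Proof.
move=> BC KC.
have [a aP] := generic_exists U_monster X_small p_type p_inv (J := 'I_n)
  id (small_count _) BC KC.
exists a; split=> [|k].
  have [_ _] := otimes_seqP U_monster B_small X_small p_type p_inv; apply=> // k.
  by apply: realizes_over_sub (aP k I) => u [?|[v vk <-]]; [left|right; exists v].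
apply: realizes_over_sub (generic_strong p_type p_inv p_comm BC aP (j := k) I).
by move=> u [?|[v vk <-]]; [left|right; exists v => //; split=> //; right].
Qed.

(** A realization of the product has independent components. As [r] agrees with the product on the
    variables in [M], independence transfers to realizations of [r]. *)
Lemma independent_base (M : {set 'I_n}) : #|M| = m ->
  (forall i : 'I_m -> 'I_n, (forall k l : 'I_m, (k < l)%N -> (i k < i l)%N) ->
     forall q : set (formula L (tuple_vars (X \o i) + U)), complete_type q ->
       frename (@select_vars L U n m X i) @` q `<=` otimes_seq B p ->
       frename (@select_vars L U n m X i) @` q `<=` r) ->
  independent_on M.
Proof.
move=> Mm agree C BC KC a ra k kM.
have [Pc _ _] := otimes_seqP U_monster B_small X_small p_type p_inv.
have [a' [Pa' a'P]] := otimes_seq_realized BC KC.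
pose i (j : 'I_m) : 'I_n :=
  tnth (in_tuple (enum M)) (cast_ord (esym (etrans (esym (cardE M)) Mm)) j).
have i_lt (j l : 'I_m) : (j < l)%N -> (i j < i l)%N.
  move=> jl; have Ms : sorted ltn [seq val x | x <- enum M].
    rewrite /enum_mem -enumT.
    apply: (subseq_sorted ltn_trans (map_subseq _ (filter_subseq _ _))).
    by rewrite val_enum_ord iota_ltn_sorted.
  have Msz : size (enum M) = m by rewrite -cardE.
  have iE (h : 'I_m) : val (i h) = nth 0%N [seq val x | x <- enum M] h.
    by rewrite (nth_map k) ?Msz// /i (tnth_nth k).
  rewrite [X in (X < _)%N]iE [X in (_ < X)%N]iE.
  by apply: (sorted_ltn_nth ltn_trans) => //; rewrite inE size_map Msz ltn_ord.
have iM x : x \in M -> exists j, i j = x.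
  move=> xM; have /tnthP[j ->] : x \in in_tuple (enum M) by rewrite mem_enum.
  by exists (cast_ord (etrans (esym (cardE M)) Mm) j); rewrite /i cast_ordK.
pose sel := @select_vars L U n m X i.
pose q := [set chi | otimes_seq B p (frename sel chi)].
have qc : complete_type q.
  split=> [F Ffin Fq|phi]; last exact: (Pc.2 (frename sel phi)).
  have [||e eP] := Pc.1 (frename sel @` F); first exact: finite_image.
    by move=> _ [chi /Fq ? <-].
  exists (fun v => e (existT X (i (projT1 v)) (projT2 v))) => chi Fchi.
  have := eP (frename sel chi); rewrite sat_rename.
  rewrite (_ : _ \o _ = copair (fun v => e (existT X (i (projT1 v)) (projT2 v))) id).
    by apply; exists chi.
  by apply/funext => -[].
have qr : frename sel @` q `<=` r by apply: (agree i i_lt q qc) => _ [chi + <-].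
have eq_aa' : eqtp C [set v : tuple_vars X | projT1 v \in M] a' a.
  have imp phi : params phi `<=` C -> (forall v, fvars phi (inl v) -> projT1 v \in M) ->
      sat (copair a' id) phi -> sat (copair a id) phi.
    move=> phiC phiM; rewrite -(realizes_overE Pc Pa' phiC) => Pphi.
    apply: ra => //; have [|chi chiE _] := @frename_lift L _ phi _ sel setT.
      move=> [[j x] /phiM /= /iM[l jl]|u _]; last by exists (inr u).
      by subst j; exists (inl (existT _ l x)).
    by apply: qr; exists chi => //; rewrite /q /= chiE.
  move=> phi phiC phiM; split; first exact: imp.
  move=> sa; apply: contrapT => nsa'; apply: (imp (Neg phi)) sa => //.
    by move=> u [|//]; exact: phiC.
  by move=> v [|//]; exact: phiM.
pose E := [set v : tuple_vars X | projT1 v \in M /\ projT1 v != k].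
have := @realizes_transfer L U (X k) (tuple_vars X) (p k) B C (p_type k) (p_inv k) BC E
  a' a (existT X k); apply.
  by apply: eqtp_sub eq_aa' => // v [[]//|[x _ <-]].
by apply: realizes_over_sub (a'P k) => u [?|[v [_ vk] <-]]; [left|right; exists v].
Qed.

Local Notation J := (pos *l 'I_n)%type.
Local Notation J3 := (nat *l (pos *l 'I_n))%type.

(* The array is built in three stages: [z0] supplies what lies to the left of
   the cuts, then [a] is placed at the cuts and realizes [r] over [z0], then
   [z2] supplies the rest.  In [J3] the first coordinate is the stage.  The
   components of [a] that do not appear at a cut become parameters, in [D]. *)
Lemma independent_step (M : {set 'I_n}) : (m < #|M|)%N ->
  (forall k, k \in M -> independent_on (M :\ k)%SET) -> independent_on M.
Proof.
move=> mM IH C BC KC a0 ra0 k0 k0M.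
(* The columns: [k0] comes first, so that [i ord0] is [k0], followed by [m] other elements of
   [M]. *)
pose s := k0 :: take m (enum (M :\ k0)%SET).
have s_size : size s = m.+1.
  by rewrite /= size_takel// -cardE -ltnS; move: mM; rewrite (cardsD1 k0) k0M.
have s_uniq : uniq s.
  rewrite /= take_uniq ?enum_uniq// andbT; apply/negP => /mem_take.
  by rewrite mem_enum !inE eqxx.
have sM x : x \in s -> x \in M.
  by rewrite inE => /orP[/eqP->//|/mem_take]; rewrite mem_enum !inE => /andP[].
pose i (j : 'I_m.+1) : 'I_n := nth k0 s j.
have i_inj : injective i.
  move=> j j' /eqP; rewrite nth_uniq ?s_size// => /eqP; exact: val_inj.
have iM j : i j \in M by apply/sM/mem_nth; rewrite s_size.
have KV : small K [set: tuple_vars X] by exact: small_tuple.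
pose kJ (x : J) : 'I_n := x.2.
have sJ : small K [set: J] by exact: (small_count (nat * int * 'I_n)%type).
have KJ : small K [set: fam_vars X kJ].
  exact: (small_fam_vars U_monster X_small kJ sJ).
have [z0 z0P] := generic_exists U_monster X_small p_type p_inv kJ sJ BC KC.
pose C0 := C `|` range z0.
have BC0 : B `<=` C0 by apply: subset_trans BC _; exact: subsetUl.
have KC0 : small K C0 by apply: small_setU => //; exact: small_range.
have [a ra] := realizes_over_exists U_monster r_type KV KC0.
pose C1 := C0 `|` range a.
have BC1 : B `<=` C1 by apply: subset_trans BC0 _; exact: subsetUl.
have KC1 : small K C1 by apply: small_setU => //; exact: small_range.
have [z2 z2P] := generic_exists U_monster X_small p_type p_inv kJ sJ BC1 KC1.
pose kJ3 (x : J3) : 'I_n := x.2.2.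
pose w : fam_vars X kJ3 -> U := fun v => match v with existT y x =>
  match y.1 with
  | 0 => z0 (existT (fun y => X (kJ y)) y.2 x)
  | 1 => a (existT X y.2.2 x)
  | _ => z2 (existT (fun y => X (kJ y)) y.2 x)
  end end.
(* The component [i l] of [a] is dropped. The position [cut 0] is a placeholder that makes each
   other component indexed by [M] occur once. *)
pose F (l : 'I_m.+1) : set J3 := [set x | match x.1 with
  | 0 => True
  | 1 => x.2.1 = cut 0 /\ x.2.2 \in (M :\ i l)%SET
  | 2 => True
  | _ => False end].
(* The middle stage is generic by the induction hypothesis for [M] without [i l], applied over [C0];
   the outer stages are generic by construction. *)
have w_generic l : generic p C (F l) w.
  have lt3 (x y : J3) : (x < y)%O -> (x.1 < y.1)%N \/ x.1 = y.1 /\ (x.2 < y.2)%O.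
    case: x y => [x x'] [y y']; rewrite ltxi_pair !leEnat /= => /andP[].
    by rewrite leq_eqVlt => /orP[/eqP -> /implyP/(_ (leqnn _))|]; [right|left].
  move=> [[|[|[|?]]] [t k]] //= Fx.
  - apply: realizes_over_sub (z0P (t, k) I) => u.
    move=> [Cu|[[[h y] x] /= [_ /lt3[//|/= [h0 yy]]] <-]]; [by left|right].
    by subst h; exists (existT (fun y => X (kJ y)) y x).
  - have [/= t0 /= kM] := Fx.
    apply: realizes_over_sub (IH (i l) (iM l) C0 BC0 KC0 a ra k kM) => u.
    move=> [Cu|]; first by do 2!left.
    move=> [[[h y] x] /= [Fy /lt3[/= lth|/= [h1 yy]]] <-].
      by case: h lth Fy x => // _ Fy x; left; right; eexists.
    subst h; right; have [/= y0 /= yM] := Fy; exists (existT X y.2 x) => //; split=> //.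
    by move: yy; case: y y0 yM x Fy => [t' k'] /= -> _ _ _;
      rewrite ltxi_pair t0 lexx /= lt_neqAle => /andP[].
  - apply: realizes_over_sub (z2P (t, k) I) => u.
    move=> [Cu|]; first by do 3!left.
    move=> [[[h y] x] /= [Fy /lt3[/= lth|/= [h1 yy]]] <-].
      case: h lth Fy x => [|[|//]] _ Fy x; first by left; left; right; eexists.
      by left; right; eexists.
    by subst h; right; exists (existT (fun y => X (kJ y)) y x).
pose D := C `|` a @` [set v : tuple_vars X | projT1 v \in M /\ forall j, projT1 v != i j].
have BD : B `<=` D by apply: subset_trans BC _; exact: subsetUl.
have KD : small K D by exact: (small_setU_image U_monster).
pose zz (t : pos) (j : 'I_m.+1) : X (i j) -> U :=
  if (t < cut j)%O then fun x => z0 (existT (fun y => X (kJ y)) (t, i j) x)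
  else if t == cut j then fun x => a (existT X (i j) x)
  else fun x => z2 (existT (fun y => X (kJ y)) (t, i j) x).
pose idx (t : pos) (j : 'I_m.+1) : J3 :=
  if (t < cut j)%O then (0%N, (t, i j))
  else if t == cut j then (1%N, (cut 0, i j)) else (2, (t, i j)).
have zzP t j x : exists2 v : fam_vars X kJ3, projT1 v = idx t j & w v = zz t j x.
  rewrite /zz /idx; case: ifP => _.
    by exists (existT (fun y => X (kJ3 y)) (0%N, (t, i j)) x).
  case: ifP => _.
    by exists (existT (fun y => X (kJ3 y)) (1%N, (cut 0, i j)) x).
  by exists (existT (fun y => X (kJ3 y)) (2, (t, i j)) x).
have idxK t j : kJ3 (idx t j) = i j.
  by rewrite /idx; case: ifP => // _; case: ifP.
have idxF (l : 'I_m.+1) t j : (t, j) <> (cut l, l) -> F l (idx t j).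
  rewrite /idx; case: ifP => // _; case: eqP => // tj ntj.
  split=> //=; rewrite !inE iM andbT (inj_eq i_inj); apply/eqP => jl.
  by apply: ntj; rewrite tj jl.
(* Within a column the order of stages agrees with that of positions; between columns
   [generic_strong] ignores the order. *)
have idx_lt t t' j : (t' < t)%O -> (idx t' j < idx t j)%O.
  move=> tt; rewrite /idx; have [tc|tc|tc] := ltgtP t (cut j).
  - by rewrite (lt_trans tt tc) !ltxi_pair !lexx /= (ltW tt) leNgt tt.
  - have [_|_|_] := ltgtP t' (cut j); rewrite !ltxi_pair //.
    by rewrite !lexx /= (ltW tt) leNgt tt.
  - by rewrite -tc tt ltxi_pair.
have zz_real t j D' : realizes_over (p (kJ3 (idx t j))) D'
    (fun x => w (existT (fun y => X (kJ3 y)) (idx t j) x)) ->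
    realizes_over (p (i j)) D' (zz t j).
  by rewrite /zz /idx; case: ifP => // _; case: ifP.
have zz_generic (l : 'I_m.+1) (t : pos) (j : 'I_m.+1) :
    (t, j) <> (cut l, l) -> realizes_over (p (i j))
    (D `|` [set u | exists t' j' x, [/\ (t', j') <> (cut l, l),
       j' != j \/ (t' < t)%O & u = zz t' j' x]]) (zz t j).
  move=> tj; apply: zz_real.
  have H := generic_strong p_type p_inv p_comm BC (w_generic l) (idxF l t j tj).
  apply: (realizes_over_sub _ H) => u [[Cu|[[k x] /= [kM ki] <-]]|].
  - by left.
  - right; exists (existT (fun y => X (kJ3 y)) (1%N, (cut 0, k)) x) => //=.
    split; last by right; rewrite idxK; exact: ki.
    by split=> //; rewrite !inE ki.
  - move=> [t' [j' [x [tj' jj ->]]]]; right.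
    have [v vE <-] := zzP t' j' x; exists v => //=.
    rewrite vE; split; first exact: idxF.
    have [ej|nj] := eqVneq j' j; last by right; rewrite !idxK (inj_eq i_inj).
    by case: jj; rewrite ej ?eqxx// => /idx_lt; left.
have := distal_independent U_monster T_distal (fun j => X_small (i j))
  (fun j => p_type (i j)) (fun j => p_inv (i j)) BD KD zz_generic (j := ord0).
have zz_cut (j : 'I_m.+1) : zz (cut j) j = (fun x => a (existT X (i j) x)).
  by rewrite /zz ltxx eqxx.
rewrite zz_cut => H.
pose E := [set v : tuple_vars X | projT1 v \in M /\ projT1 v != k0].
have := @realizes_transfer L U (X k0) (tuple_vars X) (p k0) B C (p_type k0) (p_inv k0) BC E
  a a0 (existT X k0); apply.
  apply: eqtp_sub (eqtp_realizes r_type _ ra0) => //.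
  by apply: realizes_over_sub ra; exact: subsetUl.
apply: (realizes_over_sub _ H) => u [Cu|[[k x] /= [kM kk0] <-]].
  by do 2!left.
(* Every other component in [M] lies either at a cut or among the parameters [D]. *)
have [[j kj]|nk] := pselect (exists j, k = i j).
  subst k; right; exists j, x; split; last by rewrite zz_cut.
  have ij : i j != k0 := kk0.
  by apply/eqP => j0; move: ij; rewrite j0 eqxx.
left; right; exists (existT X k x) => //; split=> // j.
by apply/eqP => kj; apply: nk; exists j.
Qed.

Lemma independent_all (M : {set 'I_n}) : (m <= #|M|)%N ->
  (forall M : {set 'I_n}, #|M| = m -> independent_on M) -> independent_on M.
Proof.
move=> mM base; elim: {M}_.+1 {-2}M (ltnSn #|M|) mM => // h IH M Mh.
rewrite leq_eqVlt => /orP[/eqP/esym/base//|mM].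
apply: independent_step => // k kM; have cM := cardsD1 k M; rewrite kM in cM.
by apply: IH; move: Mh mM; rewrite cM.
Qed.

End Determinacy.

Theorem proposition7p6 (L : language) (T : theory L) (K : Type)
    (U : structure L)
    (T_complete : complete_theory T) (T_infinite : has_infinite_model T)
    (U_monster : monster T K U)
    (B : set U) (B_small : small K B)
    (m n : nat) (T_distal : distal K U m) (m_lt_n : m < n) (m_gt0 : 0 < m)
    (X : 'I_n -> Type) (X_small : forall i, small K [set: X i]%classic)
    (p : forall i : 'I_n, set (formula L (X i + U)))
    (p_type : forall i, complete_type (p i))
    (p_inv : forall i, invariant_type B (p i))
    (p_comm : forall i j : 'I_n, i != j -> commuting_types B (p i) (p j)) :
  determined_type m (otimes_seq B p).
Proof.
have K_nat := monster_large_nat U_monster.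
have [Pc Pinv Preal] := otimes_seqP U_monster B_small X_small p_type p_inv.
split=> // r r_type agree.
have indep : independent_on K B p r [set: 'I_n]%SET.
  apply: (independent_all U_monster T_distal X_small p_type p_inv p_comm r_type).
    by rewrite cardsT card_ord ltnW.
  by move=> M Mm; exact: (independent_base U_monster B_small X_small p_type p_inv p_comm Mm agree).
apply/funext => phi; apply/propext.
(* A realization of [r] over [C] has independent components, hence also realizes the product over
   [C]; so both types give the same verdict on [phi]. *)
pose C := B `|` params phi.
have BC : B `<=` C by exact: subsetUl.
have pC : params phi `<=` C by exact: subsetUr.
have KC : small K C by apply: small_setU => //; exact/small_finite/params_finite.
have KV : small K [set: tuple_vars X] by exact: small_tuple.
have [a ra] := realizes_over_exists U_monster r_type KV KC.
have Pa : realizes_over (otimes_seq B p) C a.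
  apply: Preal => // k.
  apply: realizes_over_sub (indep C BC KC a ra k _); last by rewrite inE.
  move=> u [Cu|[v vk <-]]; [by left|right; exists v => //].
  by split; rewrite ?inE// neq_ltn vk.
by rewrite (realizes_overE r_type ra pC) (realizes_overE Pc Pa pC).
Qed.
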